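(* Let $n\ge 2$. For all primes $p$ sufficiently large in terms of $n$, and for every non-zero matrix $M\in \mathsf{M}_n(\overline{\mathbb{F}}_p)$ with $\operatorname{tr}(M)=0$, we have $$\dim\{(U,V)\in \mathsf{M}_n(\overline{\mathbb{F}}_p)^2:\ UV-VU=M\}\le n^2+1.$$
   Context: $\mathsf{M}_n(\overline{\mathbb{F}}_p)$ denotes the $n\times n$ matrices over an algebraic closure $\overline{\mathbb{F}}_p$ of $\mathbb{F}_p$; the set in question is an affine variety over $\overline{\mathbb{F}}_p$ and $\dim$ is its dimension. *)

(* Defs.v *)
From HB Require Import structures.
From mathcomp Require Import all_boot all_order all_algebra.
From mathcomp Require Import mpoly.

Set Implicit Arguments.
Unset Strict Implicit.
Unset Printing Implicit Defensive.

Import GRing.Theory.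
Local Open Scope ring_scope.

(* An algebraic closure of F along iota: K is algebraically closed by its
   type, and every element of K is a root of a monic polynomial over F. *)
Definition is_algebraic_closure (F : fieldType) (K : closedFieldType)
  (iota : {rmorphism F -> K}) : Prop := integralRange iota.

Section ZariskiTopology.

Variables (K : closedFieldType) (N : nat).

(* Points of affine N-space are row vectors; subsets are Prop-valued. *)
Implicit Types (X Z A B : 'rV[K]_N -> Prop).

Definition zero_locus (S : {mpoly K[N]} -> Prop) : 'rV[K]_N -> Prop :=
  fun x => forall f, S f -> f.@[fun i => x 0 i] = 0.

Definition included A B : Prop := forall x, A x -> B x.

(* Z is a subset of X that is closed for the topology induced on X by the
   Zariski topology of affine space. *)
Definition closed_in X Z : Prop :=
  exists S : {mpoly K[N]} -> Prop, forall x, Z x <-> X x /\ zero_locus S x.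

Definition irreducible Z : Prop :=
  (exists x, Z x) /\
  forall A B, closed_in Z A -> closed_in Z B ->
    (forall x, Z x -> A x \/ B x) -> included Z A \/ included Z B.

(* Z 0 < Z 1 < ... < Z k is a strictly increasing chain, of length k, of
   irreducible closed subsets of X; the values Z i with k < i are junk. *)
Definition irreducible_chain X (k : nat) (Z : nat -> 'rV[K]_N -> Prop) : Prop :=
  (forall i, (i <= k)%N -> closed_in X (Z i) /\ irreducible (Z i)) /\
  (forall i, (i < k)%N -> included (Z i) (Z i.+1) /\ ~ included (Z i.+1) (Z i)).

(* dim X <= d, where dim X is the Krull dimension, i.e. the supremum of the
   lengths of the chains above. *)
Definition dim_le X (d : nat) : Prop :=
  forall (k : nat) (Z : nat -> 'rV[K]_N -> Prop),
    irreducible_chain X k Z -> (k <= d)%N.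

End ZariskiTopology.

(* M_n(K)^2 is identified with affine space of dimension 2n^2 by listing the
   entries of U followed by those of V. *)
Definition pair_point (K : closedFieldType) (n : nat) (U V : 'M[K]_n) :
    'rV[K]_(n * n + n * n) :=
  row_mx (mxvec U) (mxvec V).

Definition commutator_fibre (K : closedFieldType) (n : nat) (M : 'M[K]_n) :
    'rV[K]_(n * n + n * n) -> Prop :=
  fun x => exists U V : 'M[K]_n,
    x = pair_point U V /\ U *m V - V *m U = M.

(* Main.v *)
Require Import Defs.
From HB Require Import structures.
From mathcomp Require Import all_boot all_order all_algebra.
From mathcomp Require Import all_field perm boolp ring zify.
From mathcomp Require Import mpoly.

Set Implicit Arguments.
Unset Strict Implicit.
Unset Printing Implicit Defensive.

Import GRing.Theory.
Local Open Scope ring_scope.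

(* Let x = (U, V) be the generic point of an irreducible closed subset of the
   fibre, over a field L where the characteristic polynomial of U splits.  A
   strict chain of length k ending in that subset gives k algebraically
   independent functions of x, so it is enough to see that all entries of U and
   V are algebraic over the field generated by K and n^2 + 1 elements of L.

   If U has a single eigenvalue a, count 1 for a, some number s for the nilpotent
   part N, and n^2 - s for V, which lies in a coset of the centralizer of N; the
   value of s comes from an induction that restricts N to its image.
   Otherwise conjugate U to diag(U1, U2), where U1 has the single eigenvalue a
   of U and U2 does not have it.  The conjugating matrix depends on 2 m1 m2
   parameters, and the top left block of the conjugate of M, being the
   commutator [U1, V11], has trace zero: as M is not scalar (here p > n is used)
   this removes one parameter.  The off-diagonal blocks of V solve Sylvester
   equations, so they are free of charge, and the diagonal blocks contribute at
   most m1^2 + 1 and m2^2 + 1 by induction, in total n^2 + 1.  The induction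
   needs that the compression of M to the second block does not vanish or that
   U2 has one eigenvalue; some choice of a achieves this, because M is determined
   by its compressions to the complements of three spectral subspaces. *)

(** * Subfields and algebraic closure inside a field *)

Section Subfield.

Variable L : fieldType.
Implicit Types (P R S T : L -> Prop).

Definition subring P : Prop :=
  [/\ P 1, forall x y, P x -> P y -> P (x - y)
     & forall x y, P x -> P y -> P (x * y)].

Definition subfield P : Prop :=
  [/\ P 1, forall x y, P x -> P y -> P (x - y)
     & forall x y, P x -> P y -> P (x / y)].

(** The proof is an argument so that canonical algebraic structures can be attached to the
    predicate, which turns a Prop-valued subfield into a field type. *)
Definition subfield_pred P (_ : subfield P) : {pred L} := fun x => `[< P x >].

Lemma subfield_divring P (hP : subfield P) : divring_closed (subfield_pred hP).
Proof.
case: (hP) => [h1 h2 h3]; split; first exact/asboolP.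
- by move=> x y /asboolP hx /asboolP hy; apply/asboolP; apply: h2.
- by move=> x y /asboolP hx /asboolP hy; apply/asboolP; apply: h3.
Qed.

HB.instance Definition _ P (hP : subfield P) :=
  GRing.isDivringClosed.Build L (subfield_pred hP) (subfield_divring hP).

Definition subfield_type P (hP : subfield P) := {x : L | subfield_pred hP x}.

HB.instance Definition _ P (hP : subfield P) :=
  SubChoice.on (subfield_type hP).
HB.instance Definition _ P (hP : subfield P) :=
  [SubChoice_isSubComUnitRing of subfield_type hP by <:].
HB.instance Definition _ P (hP : subfield P) :=
  [SubComUnitRing_isSubIntegralDomain of subfield_type hP by <:].
HB.instance Definition _ P (hP : subfield P) :=
  [SubIntegralDomain_isSubField of subfield_type hP by <:].

(** The relative algebraic closure in [L] of the field generated by [S]. Being algebraic over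
    elements already reached is a constructor, so transitivity comes for free;
    [algebraic_over_subfield] recovers a single polynomial equation. *)
Inductive acl S : L -> Prop :=
| acl_in x of S x : acl S x
| acl1 : acl S 1
| aclB x y of acl S x & acl S y : acl S (x - y)
| acl_div x y of acl S x & acl S y : acl S (x / y)
| acl_root (p : {poly L}) x of
    p != 0 & (forall i, acl S p`_i) & root p x : acl S x.

Lemma acl_trans S T u : (forall x, S x -> acl T x) -> acl S u -> acl T u.
Proof.
move=> hST; elim=> {u} [x /hST //||x y _ hx _ hy|x y _ hx _ hy|p x p0 _ hp px].
- exact: acl1.
- exact: aclB.
- exact: acl_div.
- exact: (acl_root p0 hp px).
Qed.

Lemma acl_subset S T u : (forall x, S x -> T x) -> acl S u -> acl T u.
Proof. by move=> h; apply: acl_trans => x /h; apply: acl_in. Qed.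

Section Closure.
Variable S : L -> Prop.
Local Notation A := (acl S).

Lemma acl0 : A 0.
Proof. by rewrite -(subrr 1); apply: aclB; apply: acl1. Qed.

Lemma aclN x : A x -> A (- x).
Proof. by move=> hx; rewrite -sub0r; apply: aclB => //; apply: acl0. Qed.

Lemma aclD x y : A x -> A y -> A (x + y).
Proof. by move=> hx hy; rewrite -[y]opprK; apply: aclB => //; apply: aclN. Qed.

Lemma aclV x : A x -> A x^-1.
Proof. by move=> hx; rewrite -div1r; apply: acl_div => //; apply: acl1. Qed.

Lemma aclM x y : A x -> A y -> A (x * y).
Proof. by move=> hx hy; rewrite -[y]invrK; apply: acl_div => //; apply: aclV. Qed.

Lemma acl_sum (I : finType) (Q : pred I) (f : I -> L) :
  (forall i, A (f i)) -> A (\sum_(i | Q i) f i).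
Proof. by move=> hf; elim/big_ind: _ => //; [exact: acl0|exact: aclD]. Qed.

Lemma acl_prod (I : finType) (Q : pred I) (f : I -> L) :
  (forall i, A (f i)) -> A (\prod_(i | Q i) f i).
Proof. by move=> hf; elim/big_ind: _ => //; [exact: acl1|exact: aclM]. Qed.

Lemma aclX x n : A x -> A (x ^+ n).
Proof.
by move=> hx; elim: n => [|n ih]; rewrite ?expr0 ?exprS; [apply: acl1|apply: aclM].
Qed.

Lemma acl_natr n : A n%:R.
Proof.
elim: n => [|n ih]; first exact: acl0.
by rewrite -addn1 natrD; apply: aclD => //; apply: acl1.
Qed.

End Closure.

(** With [P] packaged as a field type, elements algebraic over it are closed under the field
    operations, and integrality over a field gives closure under roots. *)
Lemma algebraic_over_subfield P S u : subfield P -> (forall x, S x -> P x) ->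
  acl S u -> exists p : {poly L}, [/\ p != 0, forall i, P p`_i & root p u].
Proof.
move=> hP hS; pose F := subfield_type hP; pose i : {rmorphism F -> L} := \val.
move=> hu; have [q q0 qu] : algebraicOver i u.
  elim: hu => {u} [x /hS/asboolP hx||x y _ hx _ hy|x y _ hx _ hy|p x p0 _ hp px].
  - by have -> : x = i (Sub x hx) by []; apply: algebraic_id.
  - exact: algebraic1.
  - exact: algebraic_sub.
  - exact: algebraic_div.
  - apply/integral_algebraic/(integral_root p0 px) => c /(nthP 0)[k _ <-].
    exact/integral_algebraic.
exists (map_poly i q); split=> //; first by rewrite map_poly_eq0.
by move=> k; rewrite coef_map; apply/asboolP/(valP q`_k).
Qed.

Definition frac R x : Prop := exists a b, [/\ R a, R b, b != 0 & x = a / b].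

Lemma frac_subfield R : subring R -> subfield (frac R).
Proof.
case=> [R1 RB RM].
have R0 : R 0 by rewrite -(subrr 1); apply: RB.
split; first by exists 1, 1; split=> //; rewrite ?oner_eq0 ?divr1.
- move=> _ _ [a [b [Ra Rb b0 ->]]] [c [d [Rc Rd d0 ->]]].
  exists (a * d - c * b), (b * d); split; rewrite ?mulf_neq0 //.
  - by apply: (RB); apply: (RM).
  - exact: RM.
  - field; rewrite ?b0 ?d0 //.
- move=> _ _ [a [b [Ra Rb b0 ->]]] [c [d [Rc Rd d0 ->]]].
  have [-> |c0] := eqVneq c 0.
    by exists 0, 1; split=> //; rewrite ?oner_eq0 // !mul0r invr0 mulr0.
  exists (a * d), (b * c); split; rewrite ?mulf_neq0 //; [exact: RM|exact: RM|].
  by field; rewrite b0 c0 d0.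
Qed.

Lemma algebraic_over_subring R S u : subring R -> (forall x, S x -> R x) ->
  acl S u -> exists p : {poly L}, [/\ p != 0, forall i, R p`_i & root p u].
Proof.
move=> hR hS hu; have [R1 RB RM] := hR.
have R0 : R 0 by rewrite -(subrr 1); apply: RB.
have [|p [p0 hp pu]] := algebraic_over_subfield (frac_subfield hR) _ hu.
  by move=> x /hS hx; exists x, 1; split; rewrite ?oner_eq0 ?divr1.
(* A common denominator of the coefficients, built one coefficient at a time. *)
have [d [Rd d0 hd]] : exists d, [/\ R d, d != 0 &
    forall i, (i < size p)%N -> R (d * p`_i)].
  elim: (size p) => [|m [d [Rd d0 hd]]]; first by exists 1; rewrite oner_eq0.
  have [a [b [Ra Rb b0 e]]] := hp m; exists (d * b).
  split; rewrite ?mulf_neq0 //; first exact: RM.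
  move=> i; rewrite ltnS leq_eqVlt => /orP[/eqP->|im].
    by rewrite e mulrACA -mulrA mulrCA divff // mulr1; apply: RM.
  by rewrite mulrAC; apply: RM => //; apply: hd.
exists (d *: p); split; first by rewrite scaler_eq0 negb_or d0.
- move=> i; rewrite coefZ; have [/hd //|hi] := ltnP i (size p).
  by rewrite nth_default // mulr0.
- by rewrite rootZ.
Qed.

(** * Exchange and algebraic independence *)

Definition ext S (t : seq L) : L -> Prop := fun x => S x \/ x \in t.

(** An equation for [y] with coefficients polynomial in [x] is reread as an equation for [x] with
    coefficients polynomial in [y]. It is nontrivial because [y] is transcendental over [S]. *)
Lemma acl_exchange S x y :
  acl (ext S [:: x]) y -> ~ acl S y -> acl (ext S [:: y]) x.
Proof.
move=> hy nhy.
pose R z := exists2 h : {poly L}, (forall i, acl S h`_i) & z = h.[x].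
have hR : subring R.
  split; first by exists 1; rewrite ?hornerC // => i; rewrite coef1; apply: acl_natr.
  - move=> _ _ [h hh ->] [k hk ->]; exists (h - k); rewrite ?hornerE // => i.
    by rewrite coefB; apply: aclB.
  - move=> _ _ [h hh ->] [k hk ->]; exists (h * k); rewrite ?hornerE // => i.
    by rewrite coefM; apply: acl_sum => j; apply: aclM.
have [|p [p0 hp py]] := algebraic_over_subring hR _ hy.
  move=> z [Sz|]; first by exists z%:P; rewrite ?hornerC // => i;
    rewrite coefC; case: ifP => _; [apply: acl_in|apply: acl0].
  rewrite inE => /eqP->; exists 'X; rewrite ?hornerX // => i.
  by rewrite coefX; apply: acl_natr.
have /boolp.choice [h hh] : forall j, exists h : {poly L},
    (forall i, acl S h`_i) /\ p`_j = h.[x].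
  by move=> j; have [h] := hp j; exists h.
pose q := \sum_(j < size p) y ^+ j *: h j.
have Sy u : acl S u -> acl (ext S [:: y]) u by apply: acl_subset => z; left.
have qc i : q`_i = \sum_(j < size p) (h j)`_i * y ^+ j.
  by rewrite coef_sum; apply: eq_bigr => j _; rewrite coefZ mulrC.
(* If [q] vanishes identically, the coefficient of some power of [x], read as a polynomial in [y],
   is a nonzero polynomial over [acl S] killing [y]. *)
have [q0|q0] := eqVneq q 0.
  have [i hi] : exists i, (h (size p).-1)`_i != 0.
    apply: contrapT => /forallNP h0; have : lead_coef p != 0 by rewrite lead_coef_eq0.
    rewrite lead_coefE (hh _).2 => /negP; apply; apply/eqP.
    suff -> : h (size p).-1 = 0 by rewrite horner0.
    by apply/polyP => i; rewrite coef0; apply/eqP/negPn/negP/h0.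
  case: nhy; pose r := \poly_(j < size p) (h j)`_i.
  have r0 : r != 0.
    apply: contraNneq hi => r0; have : r`_(size p).-1 = 0 by rewrite r0 coef0.
    by rewrite coef_poly prednK ?size_poly_gt0 // leqnn => ->.
  apply: (acl_root r0).
    by move=> j; rewrite coef_poly; case: ifP => _; [apply: (hh j).1|apply: acl0].
  by rewrite /root horner_poly -qc q0 coef0.
apply: (acl_root q0).
  move=> i; rewrite qc; apply: acl_sum => j; apply: aclM; first exact/Sy/(hh j).1.
  by apply: aclX; apply: acl_in; right; rewrite inE.
rewrite /root; have /eqP <- := py; apply/eqP.
rewrite (horner_coef p) /q horner_sum; apply: eq_bigr => j _.
by rewrite hornerZ mulrC (hh j).2.
Qed.

(** Each element is transcendental over [S] and the elements after it; this fits
    [chain_independent], where each new function is put in front. *)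
Fixpoint indep S (ys : seq L) : Prop :=
  if ys is y :: ys' then ~ acl (ext S ys') y /\ indep S ys' else True.

Lemma acl_ext_sub S t t' u : {subset t <= t'} -> acl (ext S t) u -> acl (ext S t') u.
Proof. by move=> h; apply: acl_subset => x [?|/h]; [left|right]. Qed.

(** The element [z] at which [y] becomes algebraic is the one that [steinitz] trades for [y]. *)
Lemma acl_ext_split S t y : ~ acl S y -> acl (ext S t) y ->
  exists t1 z t2, [/\ t = t1 ++ z :: t2, ~ acl (ext S t1) y
                    & acl (ext S (rcons t1 z)) y].
Proof.
move=> nSy; elim/last_ind: t => [|t z ih] hy.
  by case: nSy; apply: acl_subset hy => x [].
have [/ih [t1 [z' [t2 [-> h1 h2]]]]|nty] := pselect (acl (ext S t) y).
  by exists t1, z', (rcons t2 z); rewrite rcons_cat rcons_cons.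
by exists t, z, [::]; rewrite cats1.
Qed.

Lemma acl_ext_cat S t1 t2 u :
  acl (ext (ext S t1) t2) u <-> acl (ext S (t1 ++ t2)) u.
Proof.
split; apply: acl_subset => v; rewrite /ext mem_cat.
  by case=> [[h|->]|->]; [left|right|right; rewrite orbT].
by case=> [h|/orP[h|h]]; [left; left|left; right|right].
Qed.

Lemma steinitz S ys t : indep S ys -> (forall y, y \in ys -> acl (ext S t) y) ->
  (size ys <= size t)%N.
Proof.
(* Exchange invariant: the elements of [ys] replace as many elements of [t], and what remains, [t'],
   still spans [t] together with [ys]. *)
move=> iys hys; suff [t' [<- _]] : exists t', (size t' + size ys)%N = size t /\
    forall x, x \in t -> acl (ext S (ys ++ t')) x by apply: leq_addl.
elim: ys iys hys => [|y ys ih] /= iys hys.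
  by exists t; rewrite addn0; split=> // x xt; apply: acl_in; right.
case: iys => ny /ih[|t' [st' ht']]; first by move=> z hz; apply: hys; rewrite inE hz orbT.
have yt' : acl (ext (ext S ys) t') y.
  apply/acl_ext_cat; apply: acl_trans (hys y _); last by rewrite inE eqxx.
  by move=> z [Sz|/ht' //]; apply: acl_in; left.
have [t1 [z [t2 [et' n1 h1]]]] := acl_ext_split ny yt'.
exists (t1 ++ t2); split.
  by rewrite -st' et' !size_cat /= !addnS addSn.
have zt : acl (ext S (y :: ys ++ t1 ++ t2)) z.
  have: acl (ext (ext (ext S ys) t1) [:: y]) z.
    apply: acl_exchange => //; apply: acl_subset h1 => v [Sv|].
      by left; left.
    by rewrite mem_rcons inE => /orP[/eqP->|vt]; [right; rewrite inE|left; right].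
  apply: acl_subset => v [[[Sv|vy]|v1]|vz]; [by left|right..].
  - by rewrite inE mem_cat vy orbT.
  - by rewrite inE !mem_cat v1 !orbT.
  - by move: vz; rewrite !inE => ->.
move=> x /ht'; apply: acl_trans => v [Sv|]; first by apply: acl_in; left.
rewrite et' !mem_cat inE => h; have [-> //|vz] := eqVneq v z.
by apply: acl_in; right; move: h; rewrite (negPf vz) !inE !mem_cat orFb => ->; rewrite orbT.
Qed.

End Subfield.

(** * Matrices over subfields *)

Section MatrixOver.

Variable L : fieldType.
Implicit Types S : L -> Prop.

Definition mxin S m n (A : 'M[L]_(m, n)) : Prop := forall i j, acl S (A i j).

Lemma mxin_trans S T m n (A : 'M_(m, n)) :
  (forall x, S x -> acl T x) -> mxin S A -> mxin T A.
Proof. by move=> h hA i j; apply: acl_trans (hA i j). Qed.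

Lemma mxin_extl S t m n (A : 'M_(m, n)) : mxin S A -> mxin (ext S t) A.
Proof. by apply: mxin_trans => x hx; apply: acl_in; left. Qed.

Lemma mxin_ext_cat S t1 t2 m n (A : 'M_(m, n)) :
  mxin (ext (ext S t1) t2) A <-> mxin (ext S (t1 ++ t2)) A.
Proof. by split=> h i j; apply/acl_ext_cat/h. Qed.

Lemma mxin_ext_sub S t t' m n (A : 'M_(m, n)) :
  {subset t <= t'} -> mxin (ext S t) A -> mxin (ext S t') A.
Proof. by move=> h hA i j; apply: acl_ext_sub h _. Qed.

Section Closure.
Variable S : L -> Prop.

Lemma mxin0 m n : mxin S (0 : 'M_(m, n)).
Proof. by move=> i j; rewrite mxE; apply: acl0. Qed.

Lemma mxin1 n : mxin S (1%:M : 'M_n).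
Proof. by move=> i j; rewrite mxE; apply: acl_natr. Qed.

Lemma mxinB m n (A B : 'M_(m, n)) : mxin S A -> mxin S B -> mxin S (A - B).
Proof. by move=> hA hB i j; rewrite !mxE; apply: aclB. Qed.

Lemma mxinN m n (A : 'M_(m, n)) : mxin S A -> mxin S (- A).
Proof. by move=> hA i j; rewrite !mxE; apply: aclN. Qed.

Lemma mxinD m n (A B : 'M_(m, n)) : mxin S A -> mxin S B -> mxin S (A + B).
Proof. by move=> hA hB i j; rewrite !mxE; apply: aclD. Qed.

Lemma mxinZ m n a (A : 'M_(m, n)) : acl S a -> mxin S A -> mxin S (a *: A).
Proof. by move=> ha hA i j; rewrite !mxE; apply: aclM. Qed.

Lemma mxin_scalar n a : acl S a -> mxin S (a%:M : 'M_n).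
Proof. by move=> ha; rewrite -scalemx1; apply: mxinZ => //; apply: mxin1. Qed.

Lemma mxinM m n p (A : 'M_(m, n)) (B : 'M_(n, p)) :
  mxin S A -> mxin S B -> mxin S (A *m B).
Proof.
by move=> hA hB i j; rewrite mxE; apply: acl_sum => k; apply: aclM.
Qed.

Lemma mxin_tr m n (A : 'M_(m, n)) : mxin S A -> mxin S A^T.
Proof. by move=> hA i j; rewrite mxE. Qed.

Lemma mxin_delta m n i j : mxin S (delta_mx i j : 'M_(m, n)).
Proof. by move=> k l; rewrite mxE; apply: acl_natr. Qed.

Lemma mxin_perm n (s : 'S_n) : mxin S (perm_mx s : 'M_n).
Proof. by move=> i j; rewrite !mxE; apply: acl_natr. Qed.

Lemma acl_trace n (A : 'M_n) : mxin S A -> acl S (\tr A).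
Proof. by move=> hA; apply: acl_sum. Qed.

Lemma acl_det n (A : 'M_n) : mxin S A -> acl S (\det A).
Proof.
move=> hA; apply: acl_sum => s; apply: aclM; last exact: acl_prod.
by apply: aclX; apply: aclN; apply: acl1.
Qed.

Lemma mxin_inv n (A : 'M_n) : mxin S A -> mxin S (invmx A).
Proof.
move=> hA; rewrite /invmx; case: ifP => // _; apply: mxinZ.
  by apply: aclV; apply: acl_det.
move=> i j; rewrite mxE /cofactor; apply: aclM.
  by apply: aclX; apply: aclN; apply: acl1.
by apply: acl_det => k l; rewrite !mxE.
Qed.

Lemma mxin_row m n1 n2 (A : 'M_(m, n1)) (B : 'M_(m, n2)) :
  mxin S (row_mx A B) <-> mxin S A /\ mxin S B.
Proof.
split=> [h|[hA hB] i j]; last by rewrite mxE; case: split.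
by split=> i j; [have := h i (lshift _ j)|have := h i (rshift _ j)];
  rewrite ?row_mxEl ?row_mxEr.
Qed.

Lemma mxin_col m1 m2 n (A : 'M_(m1, n)) (B : 'M_(m2, n)) :
  mxin S (col_mx A B) <-> mxin S A /\ mxin S B.
Proof.
split=> [h|[hA hB] i j]; last by rewrite mxE; case: split.
by split=> i j; [have := h (lshift _ i) j|have := h (rshift _ i) j];
  rewrite ?col_mxEu ?col_mxEd.
Qed.

Lemma mxin_block m1 m2 n1 n2 (A : 'M_(m1, n1)) (B : 'M_(m1, n2))
    (C : 'M_(m2, n1)) (D : 'M_(m2, n2)) :
  mxin S (block_mx A B C D) <-> [/\ mxin S A, mxin S B, mxin S C & mxin S D].
Proof.
rewrite /block_mx; split=> [/mxin_col[/mxin_row[? ?] /mxin_row[? ?]] //|].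
by case=> *; apply/mxin_col; split; apply/mxin_row.
Qed.

End Closure.

Definition entries m n (A : 'M[L]_(m, n)) : seq L :=
  [seq A ij.1 ij.2 | ij : 'I_m * 'I_n].

Lemma size_entries m n (A : 'M_(m, n)) : size (entries A) = (m * n)%N.
Proof. by rewrite size_map -cardE card_prod !card_ord. Qed.

Lemma mem_entries m n (A : 'M_(m, n)) i j : A i j \in entries A.
Proof. by apply/mapP; exists (i, j); rewrite ?mem_enum. Qed.

Lemma mxin_entries S m n (A : 'M_(m, n)) : mxin (ext S (entries A)) A.
Proof. by move=> i j; apply: acl_in; right; apply: mem_entries. Qed.

Lemma row_pivots m1 m2 (A : 'M[L]_(m1 + m2, m1)) : row_full A ->
  exists s : 'S_(m1 + m2), usubmx (perm_mx s *m A) \in unitmx.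
Proof.
move=> Afull; pose f := fullrankfun Afull.
have f_inj : injective f by apply: fullrankfun_inj.
have f_uniq : uniq (codom f) by exact/injectiveP.
(* The permutation lists the rows of a maximal minor first, then all the others. *)
pose l := codom f ++ [seq x <- enum 'I_(m1 + m2) | x \notin codom f].
have lperm : perm_eq l (enum 'I_(m1 + m2)).
  apply: uniq_perm; rewrite ?enum_uniq // ?cat_uniq.
    rewrite filter_uniq ?enum_uniq // andbT f_uniq /=.
    by apply/hasPn => x; rewrite mem_filter => /andP[].
  by move=> x; rewrite mem_cat mem_filter mem_enum andbT orbN.
have lsize : size l = (m1 + m2)%N by rewrite (perm_size lperm) size_enum_ord.
have luniq : uniq l by rewrite (perm_uniq lperm) enum_uniq.
pose h (i : 'I_(m1 + m2)) := nth i l i.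
have h_inj : injective h.
  move=> i j; rewrite /h (set_nth_default i) ?lsize // => /eqP.
  by rewrite nth_uniq ?lsize // => /eqP/val_inj.
exists (perm h_inj).
suff -> : usubmx (perm_mx (perm h_inj) *m A) = rowsub f A by apply: fullrowsub_unit.
apply/matrixP => i j; rewrite -row_permE !mxE permE /h nth_cat size_codom card_ord /=.
rewrite ltn_ord; congr (A _ j).
by rewrite (nth_map i) ?size_enum_ord // nth_ord_enum.
Qed.

Lemma col_pivots m1 m2 (A : 'M[L]_(m1, m1 + m2)) : row_free A ->
  exists s : 'S_(m1 + m2), lsubmx (A *m perm_mx s) \in unitmx.
Proof.
rewrite /row_free -mxrank_tr => hA; have [s hs] := row_pivots hA.
exists s^-1%g; rewrite -unitmx_tr trmx_lsub trmx_mul tr_perm_mx invgK.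
by [].
Qed.

End MatrixOver.

(** * Solutions of [U, V] = M *)

Section Commutators.

Variable L : fieldType.
Implicit Types S T : L -> Prop.

(** [X] has an invertible square block of columns, and [Y] is the matching block of [Y *m X] times
    the inverse of that block. *)
Lemma mxin_cancelr S m1 m2 k (X : 'M[L]_(m1, m1 + m2)) (Y : 'M_(k, m1)) :
  row_free X -> mxin S X -> mxin S (Y *m X) -> mxin S Y.
Proof.
move=> /col_pivots[s hs] hX hYX; pose X1 := lsubmx (X *m perm_mx s).
have mxin_l k' (A : 'M_(k', m1 + m2)) : mxin S A -> mxin S (lsubmx (A *m perm_mx s)).
  move=> hA; have : mxin S (A *m perm_mx s) by apply/mxinM/mxin_perm.
  by rewrite -{1}[A *m _]hsubmxK => /mxin_row[].
have -> : Y = lsubmx (Y *m X *m perm_mx s) *m invmx X1.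
  have -> : lsubmx (Y *m X *m perm_mx s) = Y *m X1 by rewrite -mulmxA mulmx_lsub.
  by rewrite mulmxK.
by apply: mxinM; [apply: mxin_l|apply/mxin_inv/mxin_l].
Qed.

(** The rows of [Y] facing the pivot columns of [X] can be solved for, so the [m2 * k] entries of
    the other rows are the only free unknowns. *)
Lemma mxin_solve_row_free S m1 m2 k (X : 'M[L]_(m1, m1 + m2)) (Y : 'M_(m1 + m2, k)) :
  row_free X -> mxin S X -> mxin S (X *m Y) ->
  exists t, size t = (m2 * k)%N /\ mxin (ext S t) Y.
Proof.
move=> /col_pivots[s hs] hX hXY; pose Y' := perm_mx s^-1 *m Y.
exists (entries (dsubmx Y')); split; first exact: size_entries.
set T := ext S _.
have defY : Y = perm_mx s *m Y' by rewrite mulmxA -perm_mxM mulgV perm_mx1 mul1mx.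
rewrite defY; apply: mxinM; first exact: mxin_perm.
rewrite -[Y']vsubmxK; apply/mxin_col.
have hd : mxin T (dsubmx Y') by apply: mxin_entries.
split=> //; have : mxin T (X *m perm_mx s) by apply/mxinM/mxin_perm/mxin_extl.
rewrite -{1}[X *m _]hsubmxK => /mxin_row[hl hr].
have -> : usubmx Y' = invmx (lsubmx (X *m perm_mx s)) *m
    (X *m Y - rsubmx (X *m perm_mx s) *m dsubmx Y').
  rewrite {1}defY mulmxA; move: (X *m perm_mx s) hs => A hs.
  by rewrite -{2}[A]hsubmxK -{2}[Y']vsubmxK mul_row_col addrK mulKmx.
apply: mxinM; first exact: mxin_inv.
by apply: mxinB; [apply: mxin_extl|apply: mxinM].
Qed.

(** * Unipotent block matrices as charts *)

Definition lo m1 m2 (c : 'M[L]_(m2, m1)) : 'M_(m1 + m2) := block_mx 1%:M 0 c 1%:M.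
Definition up m1 m2 (r : 'M[L]_(m1, m2)) : 'M_(m1 + m2) := block_mx 1%:M r 0 1%:M.

Lemma loK m1 m2 (c : 'M_(m2, m1)) : lo c *m lo (- c) = 1%:M.
Proof.
rewrite /lo mulmx_block !mulmx1 !mul1mx !mulmx0 !mul0mx addr0 !add0r.
by rewrite subrr -scalar_mx_block.
Qed.

Lemma loNK m1 m2 (c : 'M_(m2, m1)) : lo (- c) *m lo c = 1%:M.
Proof. by rewrite -{2}[c]opprK loK. Qed.

Lemma upK m1 m2 (r : 'M_(m1, m2)) : up r *m up (- r) = 1%:M.
Proof.
rewrite /up mulmx_block !mulmx1 !mul1mx !mulmx0 !mul0mx !addr0 !add0r.
by rewrite addNr -scalar_mx_block.
Qed.

Lemma upNK m1 m2 (r : 'M_(m1, m2)) : up (- r) *m up r = 1%:M.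
Proof. by rewrite -{2}[r]opprK upK. Qed.

Lemma mxin_lo S m1 m2 (c : 'M_(m2, m1)) : mxin S c -> mxin S (lo c).
Proof. by move=> hc; apply/mxin_block; split=> //; [apply: mxin1|apply: mxin0|apply: mxin1]. Qed.

Lemma mxin_up S m1 m2 (r : 'M_(m1, m2)) : mxin S r -> mxin S (up r).
Proof. by move=> hc; apply/mxin_block; split=> //; [apply: mxin1|apply: mxin0|apply: mxin1]. Qed.

(** After a permutation of coordinates the image of [C *m R] is the graph of [c], a chart of the
    Grassmannian. Conjugation by [lo c] moves the image to the first [m1] coordinates, so the lower
    rows vanish. *)
Lemma image_chart m1 m2 (C : 'M[L]_(m1 + m2, m1)) (R : 'M_(m1, m1 + m2)) :
  row_full C -> row_free R -> exists (s : 'S_(m1 + m2)) (c : 'M_(m2, m1)) X,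
    row_free X /\
    perm_mx s *m (C *m R) *m perm_mx s^-1 = lo c *m col_mx X 0 *m lo (- c).
Proof.
move=> /row_pivots[s]; set C1 := usubmx _ => C1u Rfree.
pose c := dsubmx (perm_mx s *m C) *m invmx C1.
exists s, c, (C1 *m R *m (perm_mx s^-1 *m lo c)); split.
  rewrite /row_free mxrankMfree; first by rewrite mxrankMfree // -/(row_free _) row_free_unit.
  rewrite row_free_unit unitmx_mul unitmx_perm /=.
  by case/mulmx1_unit: (loK c).
rewrite -[0](mul0mx _ (perm_mx s^-1 *m lo c)) -mul_col_mx -!mulmxA loK mulmx1 !mulmxA.
congr (_ *m _); rewrite /lo mul_block_col !mul1mx !mul0mx !addr0.
by rewrite mulmxA mulmxKV // -mul_col_mx vsubmxK.
Qed.

(** * Commutators with a nilpotent matrix *)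

Lemma det_exprmx n (A : 'M[L]_n) e : \det (A ^+ e) = (\det A) ^+ e.
Proof.
by elim: e => [|e ih]; rewrite ?det1 // !exprS -mulmxE det_mulmx ih.
Qed.

Lemma block_exprmx m1 m2 (A : 'M[L]_m1) (B : 'M_(m1, m2)) (D : 'M_m2) e :
  exists B', block_mx A B 0 D ^+ e = block_mx (A ^+ e) B' 0 (D ^+ e).
Proof.
elim: e => [|e [B' ih]]; first by exists 0; rewrite !expr0 [LHS]scalar_mx_block.
exists (A *m B' + B *m D ^+ e); rewrite exprS ih -mulmxE mulmx_block.
by rewrite !mul0mx !mulmx0 !addr0 !add0r !exprS.
Qed.

(** Here [s] counts parameters for [N], and [d] those for [V] once [N] and its commutator with [V]
    are known. With [m1] the rank of [N], a basis adapted to the image puts [N] in the form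
    [block_mx N1 N2 0 0]. Induction on [N1] gives [s = s1 + 2 m1 m2], for [N2] and the chart [c],
    and [d = d1 + m2 ^ 2]. *)
Lemma nilpotent_span n (N : 'M[L]_n) e : N ^+ e = 0 ->
  exists s d, [/\ (s + d = n * n)%N,
    forall S, exists t, (size t <= s)%N /\ mxin (ext S t) N &
    forall T V, mxin T N -> mxin T (N *m V - V *m N) ->
      exists t, (size t <= d)%N /\ mxin (ext T t) V].
Proof.
elim/ltn_ind: n => n ih in N *; move=> Ne.
have [n0|n_gt0] := posnP n.
  subst n; exists 0%N, 0%N; split=> // [S|T V _ _]; exists [::]; split=> //; by case.
have [m1 [C [R [Cfull Rfree defN]]]] : exists m1 (C : 'M_(n, m1)) (R : 'M_(m1, n)),
    [/\ row_full C, row_free R & N = C *m R].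
  exists (\rank N), (col_base N), (row_base N).
  by rewrite col_base_full row_base_free mulmx_base.
(* A nilpotent matrix of positive size is not invertible. *)
have lt_m1 : (m1 < n)%N.
  have rkN : \rank N = m1.
    by rewrite defN mxrankMfree //; apply/eqP.
  rewrite ltn_neqAle -{2}rkN rank_leq_row andbT; apply/eqP => em1.
  have : N \in unitmx by rewrite -row_free_unit /row_free rkN em1.
  rewrite unitmxE unitfE => /(expf_neq0 e); rewrite -det_exprmx Ne.
  by case: (n) n_gt0 => // k _; rewrite det0 eqxx.
have [m2 def_n] : exists m2, n = (m1 + m2)%N by exists (n - m1)%N; rewrite subnKC // ltnW.
subst n.
have [s [c [X [Xfree defX]]]] := image_chart Cfull Rfree.
rewrite -{}defN in defX.
have Ps : perm_mx s *m perm_mx s^-1 = 1%:M :> 'M[L]_(m1 + m2).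
  by rewrite -perm_mxM mulgV perm_mx1.
have Ps' : perm_mx s^-1 *m perm_mx s = 1%:M :> 'M[L]_(m1 + m2).
  by rewrite -perm_mxM mulVg perm_mx1.
pose G := perm_mx s^-1 *m lo c; pose G' := lo (- c) *m perm_mx s.
have GG' : G *m G' = 1%:M.
  by rewrite /G /G' mulmxA -(mulmxA _ (lo c)) loK mulmx1.
have G'G : G' *m G = 1%:M.
  by rewrite /G /G' mulmxA -(mulmxA _ (perm_mx s)) Ps mulmx1 loNK.
have NG : N = G *m col_mx X 0 *m G'.
  rewrite /G /G' !mulmxA -(mulmxA _ (lo c)) -(mulmxA _ _ (lo (- c))) -defX.
  by rewrite !mulmxA Ps' mul1mx -mulmxA Ps' mulmx1.
have hG T : mxin T c -> mxin T G /\ mxin T G'.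
  move=> hc; split; apply: mxinM; try exact: mxin_perm; apply: mxin_lo => //.
  exact: mxinN.
clearbody G G'.
have G'NG : G' *m N *m G = col_mx X 0.
  by rewrite NG !mulmxA G'G mul1mx -mulmxA G'G mulmx1.
pose N1 := lsubmx X; pose N2 := rsubmx X.
have defB : col_mx X 0 = block_mx N1 N2 0 0 :> 'M_(m1 + m2).
  by rewrite /block_mx row_mx0 hsubmxK.
have N1e : N1 ^+ e = 0.
  have conjX k : (G' *m N *m G) ^+ k = G' *m N ^+ k *m G.
    elim: k => [|k ihk]; first by rewrite !expr0 mulmx1 G'G.
    rewrite exprS ihk -mulmxE !mulmxA -(mulmxA _ G) GG' mulmx1.
    by rewrite exprS -mulmxE !mulmxA.
  have := conjX e; rewrite Ne mulmx0 mul0mx G'NG defB.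
  have [B' ->] := block_exprmx N1 N2 0 e.
  by move=> /(congr1 ulsubmx); rewrite block_mxKul => ->; apply/matrixP => i j; rewrite !mxE.
have [s1 [d1 [sd1 h1 h2]]] := ih m1 lt_m1 N1 N1e.
exists (s1 + (m1 * m2 + m2 * m1))%N, (d1 + m2 * m2)%N; split.
- rewrite !mulnDr !mulnDl -sd1; lia.
- move=> S; have [t [st ht]] := h1 S.
  exists (t ++ entries N2 ++ entries c); split.
    by rewrite !size_cat !size_entries leq_add2r.
  set T := ext S _.
  have hN1 : mxin T N1 by apply: mxin_ext_sub ht => x; rewrite mem_cat => ->.
  have hN2 : mxin T N2.
    apply: mxin_ext_sub (mxin_entries S N2) => x.
    by rewrite !mem_cat => ->; rewrite orbT.
  have hc : mxin T c.
    apply: mxin_ext_sub (mxin_entries S c) => x.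
    by rewrite !mem_cat => ->; rewrite !orbT.
  have [hG1 hG2] := hG T hc; rewrite NG defB.
  apply: mxinM => //; apply: mxinM => //.
  by apply/mxin_block; split=> //; apply: mxin0.
- move=> T V hN hM.
  (* The chart [c] is recovered from [N] alone: the permuted [N] has the rows of [Y] above those of
     [c *m Y], and [Y] is row free. *)
  pose Y := X *m lo (- c).
  have PNP : perm_mx s *m N *m perm_mx s^-1 = col_mx Y (c *m Y).
    by rewrite defX {1}/lo mul_block_col !mul1mx !mulmx0 !addr0 mul_col_mx -mulmxA.
  have [hY hcY] : mxin T Y /\ mxin T (c *m Y).
    apply/mxin_col; rewrite -PNP.
    by apply: mxinM; [apply: mxinM => //|]; apply: mxin_perm.
  have Yfree : row_free Y.
    rewrite /row_free mxrankMfree // row_free_unit.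
    by case/mulmx1_unit: (loK c).
  have hc : mxin T c := mxin_cancelr Yfree hY hcY.
  have [hG1 hG2] := hG T hc.
  have : mxin T (G' *m N *m G) by do 2!apply: mxinM => //.
  rewrite G'NG => /mxin_col[hX _].
  have /mxin_row[hN1 hN2] : mxin T (row_mx N1 N2) by rewrite hsubmxK.
  have [W defW'] : exists W, W = G' *m V *m G by exists (G' *m V *m G).
  have VW : V = G *m W *m G'.
    by rewrite defW' !mulmxA GG' mul1mx -mulmxA GG' mulmx1.
  have : mxin T (G' *m (N *m V - V *m N) *m G) by do 2!apply: mxinM => //.
  have -> : G' *m (N *m V - V *m N) *m G = col_mx X 0 *m W - W *m col_mx X 0.
    rewrite -G'NG defW' mulmxBr mulmxBl !mulmxA.
    by rewrite -[G' *m N *m G *m G']mulmxA GG' mulmx1 -[G' *m V *m G *m G']mulmxA GG' mulmx1.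
  rewrite defB -[W]submxK; move: (ulsubmx W) (ursubmx W) (dlsubmx W) (drsubmx W) (submxK W).
  move=> V11 V12 V21 V22 defW.
  rewrite !mulmx_block !mul0mx !mulmx0 !addr0 opp_block_mx add_block_mx !sub0r.
  case/mxin_block => k11 k12 k21 k22.
  (* The lower row of the commutator is [- V21 *m X], which determines [V21]. *)
  have hV21 : mxin T V21.
    apply: (mxin_cancelr Xfree hX); rewrite -[X]hsubmxK mul_mx_row.
    by apply/mxin_row; split; rewrite -[_ *m _]opprK; apply: mxinN.
  have [|t1 [st1 ht1]] := h2 T V11 hN1.
    have -> : N1 *m V11 - V11 *m N1 = N1 *m V11 + N2 *m V21 - V11 *m N1 - N2 *m V21.
      by rewrite addrAC addrK.
    by apply: mxinB => //; apply: mxinM.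
  (* The upper right block gives the product of [X] with the last [m2] columns of [W], which leaves
     [m2 * m2] free entries. *)
  have [||t2 [st2 ht2]] := mxin_solve_row_free (S := ext T t1) (Y := col_mx V12 V22) Xfree.
  + exact: mxin_extl.
  + rewrite -[X]hsubmxK mul_row_col -[_ + _](subrK (V11 *m N2)).
    by apply: mxinD; [apply: mxin_extl|apply/mxinM/mxin_extl].
  exists (t1 ++ t2); split; first by rewrite size_cat st2 leq_add2r.
  apply/mxin_ext_cat; have {ht2} /mxin_col[hV12 hV22] := ht2.
  rewrite VW -defW; apply: mxinM; last by do 2!apply: mxin_extl.
  apply: mxinM; first by do 2!apply: mxin_extl.
  by apply/mxin_block; split=> //; [apply: mxin_extl|do 2!apply: mxin_extl].
Qed.

(** * The parameter saved by the trace condition *)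

Lemma mxin_drop_entry S m n (c : 'M[L]_(m, n)) i j :
  exists t, (size t < m * n)%N /\ mxin (ext S t) (c - c i j *: delta_mx i j).
Proof.
exists [seq c kl.1 kl.2 | kl in predC1 (i, j)]; split.
  rewrite size_map -cardE; have := cardC1 (i, j); rewrite card_prod !card_ord => ->.
  by rewrite prednK // muln_gt0 (leq_trans _ (ltn_ord i)) // (leq_trans _ (ltn_ord j)).
move=> k l; rewrite !mxE; have [[-> ->]|/eqP kl] := (k, l) =P (i, j).
  by rewrite !eqxx mulr1 subrr; apply: acl0.
rewrite -[(k == i) && _]/((k, l) == (i, j)) (negPf kl) mulr0 subr0.
by apply: acl_in; right; apply/mapP; exists (k, l); rewrite ?mem_enum ?inE.
Qed.

Lemma acl_quadratic S a b d x : acl S a -> acl S b -> acl S d ->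
  a + b * x + d * x ^+ 2 = 0 -> (b != 0) || (d != 0) -> acl S x.
Proof.
move=> ha hb hd e nz; apply: (@acl_root _ S (Poly [:: a; b; d])).
- apply: contraTneq nz => p0; have pc k : (Poly [:: a; b; d])`_k = 0 by rewrite p0 coef0.
  by have := pc 1%N; have := pc 2%N; rewrite !coef_Poly /= => -> ->; rewrite eqxx.
- by move=> i; rewrite coef_Poly; case: i => [|[|[|i]]] //=; rewrite nth_nil; apply: acl0.
- by rewrite /root horner_Poly /=; apply/eqP; rewrite -[RHS]e; ring.
Qed.


Lemma mul_delta_mxE m n p q (A : 'M[L]_(m, n)) (B : 'M[L]_(p, q)) i j k l :
  (A *m delta_mx i j *m B) k l = A k i * B j l.
Proof.
rewrite mxE (bigD1 j) //= big1 => [|j' jj']; last first.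
  by rewrite mxE big1 ?mul0r // => i' _; rewrite mxE (negPf jj') andbF mulr0.
rewrite addr0 mxE (bigD1 i) //= big1 => [|i' ii']; last first.
  by rewrite mxE (negPf ii') mulr0.
by rewrite mxE !eqxx mulr1 addr0.
Qed.

Lemma trace_delta_mul m n (G : 'M[L]_(m, n)) i j : \tr (delta_mx j i *m G) = G i j.
Proof.
rewrite /mxtrace (bigD1 j) //= big1 => [|k kj].
  by rewrite -[delta_mx j i]mul1mx mul_delta_mxE mxE eqxx mul1r addr0.
by rewrite -[delta_mx j i]mul1mx mul_delta_mxE mxE (negPf kj) mul0r.
Qed.

(* The top-left block of g^-1 M g, for g = lo c *m up r, has trace
   tr (A + B c) - tr (r G) where G = D + E c - c A - c B c.  If G <> 0 this is
   a nontrivial affine equation for r; otherwise G = 0 is a nontrivial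
   quadratic equation for one entry of c, because M is not scalar. *)
Lemma trace_block_dependence S m1 m2 (M : 'M[L]_(m1 + m2)) c r :
  (0 < m1)%N -> (0 < m2)%N -> (forall a, M != a%:M) -> mxin S M ->
  \tr (ulsubmx (up (- r) *m (lo (- c) *m M *m lo c) *m up r)) = 0 ->
  exists t, [/\ (size t < 2 * (m1 * m2))%N, mxin (ext S t) c & mxin (ext S t) r].
Proof.
move=> m1_gt0 m2_gt0 + hM; rewrite -[M]submxK in hM *.
move: (ulsubmx M) (ursubmx M) (dlsubmx M) (drsubmx M) hM => A B D E.
move=> /mxin_block[hA hB hD hE] nscal {M}.
pose G := D + E *m c - c *m (A + B *m c).
have -> : lo (- c) *m block_mx A B D E *m lo c =
    block_mx (A + B *m c) B G (E - c *m B).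
  rewrite /lo !mulmx_block !mulmx1 !mul1mx !mul0mx !mulmx0 !addr0 !add0r.
  congr (block_mx _ _ _ _); rewrite !mulNmx //; last by rewrite addrC.
  by rewrite mulmxDl /G mulmxDr !mulNmx mulmxA opprD addrACA addrC.
rewrite /up !mulmx_block !mulmx1 !mul1mx !mul0mx !mulmx0 !addr0 !add0r.
rewrite block_mxKul mulNmx (raddfB mxtrace) => trG.
have [G0|/matrix0Pn[k [l Gkl]]] := eqVneq G 0; last first.
  have [t [st ht]] := mxin_drop_entry S r l k.
  exists (entries c ++ t); set T := ext S _.
  have hc : mxin T c.
    by apply: mxin_ext_sub (mxin_entries S c) => x; rewrite mem_cat => ->.
  split=> //; first by rewrite size_cat size_entries; lia.
  move: ht; set r0 := r - _ => ht.
  have hr0 : mxin T r0.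
    by apply: mxin_ext_sub ht => x; rewrite mem_cat => ->; rewrite orbT.
  have defr : r = r0 + r l k *: delta_mx l k by rewrite /r0 subrK.
  have inT m n (X : 'M_(m, n)) : mxin S X -> mxin T X by apply: mxin_extl.
  have hAB : mxin T (A + B *m c) by apply: mxinD; [|apply: mxinM]; auto.
  have hG : mxin T G.
    by apply: mxinB; [apply: mxinD|]; [|apply: mxinM..]; auto.
  suff hx : acl T (r l k).
    by rewrite defr; apply: mxinD => //; apply: mxinZ => //; apply: mxin_delta.
  (* In the trace of [r *m G] the entry [r l k] has coefficient [G k l], which is nonzero. *)
  have -> : r l k = (\tr (A + B *m c) - \tr (r0 *m G)) / G k l.
    apply: (canRL (mulfK Gkl)); apply/esym/eqP; rewrite subr_eq.
    move/eqP: trG; rewrite subr_eq0 => /eqP->; apply/eqP.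
    rewrite [in LHS]defr mulmxDl -scalemxAl raddfD /= mxtraceZ trace_delta_mul.
    by rewrite addrC.
  by apply: acl_div => //; apply: aclB; apply: acl_trace => //; apply: mxinM.
suff [i [j hij]] : exists i j, forall T, (forall x, S x -> acl T x) ->
    mxin T (c - c i j *: delta_mx i j) -> acl T (c i j).
  have [t [st ht]] := mxin_drop_entry S c i j.
  exists (t ++ entries r); set T := ext S _.
  have hr : mxin T r.
    by apply: mxin_ext_sub (mxin_entries S r) => x; rewrite mem_cat => ->; rewrite orbT.
  split=> //; first by rewrite size_cat size_entries; lia.
  have {}ht : mxin T (c - c i j *: delta_mx i j).
    by apply: mxin_ext_sub ht => x; rewrite mem_cat => ->.
  rewrite -[c](subrK (c i j *: delta_mx i j)); apply: mxinD => //.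
  apply: mxinZ; last exact: mxin_delta.
  by apply: hij => // x Sx; apply: acl_in; left.
(* For [B = 0], [G] is affine in [c], and [K i j] is the coefficient of the entry [c i j]. *)
pose K i j := E *m delta_mx i j - delta_mx i j *m A.
(* [G k l = 0] is an equation of degree at most two in [c i j]. It is nontrivial through its linear
   term when [B = 0], and otherwise through its quadratic coefficient [- B j i] at position
   [(i, j)]. *)
have quadratic T i j k l : (forall x, S x -> acl T x) ->
    mxin T (c - c i j *: delta_mx i j) ->
    ((B = 0) /\ K i j k l != 0) \/ [/\ k = i, l = j & B j i != 0] -> acl T (c i j).
  move=> hST; set x := c i j; set c0 := c - _ => hc0.
  have inT m n (X : 'M_(m, n)) : mxin S X -> mxin T X by apply: mxin_trans.
  pose d := delta_mx i j : 'M[L]_(m2, m1).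
  have hd : mxin T d by apply: mxin_delta.
  have defc : c = c0 + x *: d by rewrite /c0 subrK.
  clearbody c0; pose K0 := D + E *m c0 - c0 *m A - c0 *m B *m c0.
  pose K1 := E *m d - d *m A - d *m B *m c0 - c0 *m B *m d.
  have eG : G = K0 + x *: K1 - x ^+ 2 *: (d *m B *m d).
    rewrite /G defc /K0 /K1 !(mulmxDr, mulmxDl, mulmxA) -!scalemxAr -!scalemxAl.
    move: (E *m c0) (E *m d) (c0 *m A) (d *m A) (c0 *m B *m c0) (d *m B *m c0).
    move: (c0 *m B *m d) (d *m B *m d) => Y1 Y2 Y3 Y4 Y5 Y6 Y7 Y8.
    by apply/matrixP => u v; rewrite !mxE; ring.
  have e2 : K0 k l + K1 k l * x + - (d *m B *m d) k l * x ^+ 2 = 0.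
    move: K0 K1 (d *m B *m d) eG => X Y Z.
    rewrite G0 => /(congr1 (fun X : 'M_(m2, m1) => X k l)); rewrite !mxE => e.
    by rewrite [RHS]e; ring.
  have hK0 : mxin T K0 by do ![apply: mxinB|apply: mxinD|apply: mxinM]; auto.
  have hK1 : mxin T K1 by do ![apply: mxinB|apply: mxinD|apply: mxinM]; auto.
  have hdBd : mxin T (d *m B *m d) by do ![apply: mxinM]; auto.
  move=> hyp; apply: (acl_quadratic _ _ _ e2) => //; first exact: aclN.
  case: hyp => [[B0 nz]|[-> -> nz]].
    by rewrite /K1 B0 !mulmx0 !mul0mx !subr0 nz.
  apply/orP; right; rewrite oppr_eq0 -[_ *m d]mulmx1 mul_delta_mxE.
  rewrite -[d]mul1mx mul_delta_mxE [1%:M i i]mxE [1%:M j j]mxE !eqxx.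
  by rewrite mulr1 mul1r.
have [B0|/matrix0Pn[j [i Bji]]] := eqVneq B 0; last first.
  by exists i, j => T hST hc; apply: (quadratic T i j i j) => //; right.
have [[i [j [k [l nz]]]]|Kzero] := pselect (exists i j k l, K i j k l != 0).
  by exists i, j => T hST hc; apply: (quadratic T i j k l) => //; left.
(* If [B] and every [K i j] vanish, then [E] and [A] are the same scalar; [G = 0] then gives
   [D = 0], and the whole matrix would be scalar. *)
have {Kzero} Kzero i j k l : E k i * (j == l)%:R = (k == i)%:R * A j l.
  have : K i j k l = 0.
    by apply/eqP/negPn/negP => nz; apply: Kzero; exists i, j, k, l.
  have -> : K i j k l = (E *m delta_mx i j *m 1%:M) k l - (1%:M *m delta_mx i j *m A) k l.
    by rewrite mulmx1 mul1mx /K mxE [X in _ + X = _]mxE.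
  by rewrite !mul_delta_mxE !mxE => /eqP; rewrite subr_eq0 => /eqP.
pose i0 := Ordinal m2_gt0; pose j0 := Ordinal m1_gt0.
have defA : A = (E i0 i0)%:M.
  apply/matrixP => j l; have := Kzero i0 j i0 l.
  by rewrite eqxx mul1r mxE mulr_natr.
have defE : E = (E i0 i0)%:M.
  apply/matrixP => k i; have := Kzero i j0 k j0.
  by rewrite eqxx mulr1 => ->; rewrite {1}defA !mxE eqxx mulr1n mulr_natl.
have defD : D = 0.
  by move: G0; rewrite /G B0 mul0mx addr0 {1}defA {1}defE mul_mx_scalar mul_scalar_mx addrK.
have /eqP[] := nscal (E i0 i0).
by rewrite [RHS]scalar_mx_block -defA -defE defD B0.
Qed.

(** * Sylvester equations *)

Lemma exprmx_tr n (A : 'M[L]_n) e : (A^T) ^+ e = (A ^+ e)^T.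
Proof.
by elim: e => [|e ih]; rewrite ?trmx1 // exprS exprSr ih -!mulmxE trmx_mul.
Qed.

(** Put [N = A - a]. Then [N ^ j X (B - a) = N ^ (j + 1) X - N ^ j (A X - X B)], so, as [B - a] is
    invertible, descending induction from [N ^ e X = 0] reaches [X]. *)
Lemma sylvester S n m (A : 'M[L]_n) (B : 'M_m) (X : 'M_(n, m)) a e :
  (A - a%:M) ^+ e = 0 -> B - a%:M \in unitmx -> acl S a -> mxin S A -> mxin S B ->
  mxin S (A *m X - X *m B) -> mxin S X.
Proof.
move=> Ae Bu ha hA hB hC; set N := A - a%:M in Ae.
have hN : mxin S N by apply: mxinB => //; apply: mxin_scalar.
have hNX k : mxin S (N ^+ k).
  elim: k => [|k ih]; rewrite ?exprS -?mulmxE; [exact: mxin1|exact: mxinM].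
suff h k : (k <= e)%N -> mxin S (N ^+ (e - k) *m X).
  by have := h e (leqnn e); rewrite subnn mul1mx.
elim: k => [_|k ih ke]; first by rewrite subn0 Ae mul0mx; apply: mxin0.
have ek : (e - k = (e - k.+1).+1)%N by lia.
rewrite -[_ *m X](mulmxK Bu); apply: mxinM; last first.
  by apply/mxin_inv/mxinB => //; apply: mxin_scalar.
have -> : N ^+ (e - k.+1) *m X *m (B - a%:M) =
    N ^+ (e - k) *m X - N ^+ (e - k.+1) *m (A *m X - X *m B).
  have NX : N *m X = A *m X - a *: X by rewrite mulmxBl mul_scalar_mx.
  rewrite ek exprSr -mulmxE -(mulmxA _ N) NX; move: (N ^+ _) => Q.
  rewrite !mulmxBr mul_mx_scalar -scalemxAr !mulmxA.
  by rewrite opprB addrACA [- _ + _]addrC addrACA subrr add0r addrC.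
by apply: mxinB; [apply/ih/ltnW|apply: mxinM].
Qed.

(** * Spectral projections *)

Lemma nilpotent_shift_eq0 n m (N : 'M[L]_n) (W : 'M_(n, m)) d e e' : d != 0 ->
  N ^+ e *m W = 0 -> (N - d%:M) ^+ e' *m W = 0 -> W = 0.
Proof.
move=> d0; elim: e => [|e ih] h h'; first by rewrite -[W]mul1mx.
apply: ih => //; set W' := N ^+ e *m W.
have NW' : N *m W' = 0 by rewrite mulmxA mulmxE -exprS.
have comm k : (N - d%:M) ^+ k *m N ^+ e = N ^+ e *m (N - d%:M) ^+ k.
  have cN : GRing.comm (N - d%:M) N.
    by rewrite /GRing.comm -!mulmxE mulmxBl mulmxBr mul_mx_scalar mul_scalar_mx.
  by rewrite !mulmxE; apply/commrX/commr_sym/commrX/commr_sym.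
have : (N - d%:M) ^+ e' *m W' = 0 by rewrite mulmxA comm -mulmxA h' mulmx0.
(* Since [N] kills [W'], [N - d] acts on it as the nonzero scalar [- d]. *)
have -> : (N - d%:M) ^+ e' *m W' = (- d) ^+ e' *: W'.
  elim: e' {h'} => [|k ihk]; first by rewrite !expr0 mul1mx scale1r.
  rewrite exprSr -mulmxE -mulmxA mulmxBl NW' sub0r mul_scalar_mx -scaleNr -scalemxAr.
  by rewrite ihk scalerA exprS.
by move/eqP; rewrite scaler_eq0 expf_eq0 oppr_eq0 (negPf d0) andbF => /eqP.
Qed.

(** Write the characteristic polynomial as [('X - a) ^ (m + 1) * q] with [q] prime to ['X - a]. A
    Bezout relation [u ('X - a) ^ (m + 1) + v q = 1] makes [v q], evaluated at [U], the projection
    onto the generalized eigenspace of [a]. The last clause says that if only one other root [b] is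
    left, [U - b] is nilpotent on the complement. *)
Lemma spectral_projection n (U : 'M[L]_n) rs a :
  char_poly U = \prod_(c <- rs) ('X - c%:P) -> a \in rs ->
  exists P, [/\ P *m P = P, P *m U = U *m P & P != 0] /\
    [/\ exists e, (U - a%:M) ^+ e *m P = 0,
        exists T : 'M_n, (U - a%:M) *m T = 1%:M - P &
        forall b, {subset rs <= [:: a; b]} ->
          exists e, (U - b%:M) ^+ e *m (1%:M - P) = 0].
Proof.
case: n U => [|n] U; set p := char_poly U => defp ars.
  have : size p = 1%N by rewrite size_char_poly.
  by rewrite defp size_prod_XsubC; case: (rs) ars.
pose q := \prod_(c <- rs | c != a) ('X - c%:P); pose X1 := 'X - a%:P.
have [m defm] : exists m, p = X1 ^+ m.+1 * q.
  rewrite defp (bigID (pred1 a)) /=.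
  rewrite (eq_bigr (fun=> X1)) => [|c /eqP-> //].
  rewrite big_const_seq iter_mulr_1; exists (count (pred1 a) rs).-1.
  by rewrite prednK // -has_count has_pred1.
have cop : coprimep (X1 ^+ m.+1) q.
  rewrite coprimep_expl // coprimep_sym coprimep_XsubC /root horner_prod.
  by rewrite prodf_seq_neq0; apply/allP => c _; rewrite hornerXsubC subr_eq0 eq_sym; apply/implyP.
have /Bezout_eq1_coprimepP[[u v] /= uv] := cop.
pose h : {rmorphism {poly L} -> 'M[L]_n.+1} := horner_mx U.
have hp : h p = 0 by apply: Cayley_Hamilton.
have hX b : h ('X - b%:P) = U - b%:M by rewrite rmorphB /= [h 'X]horner_mx_X [h _]horner_mx_C.
have hQ : 1%:M - h (v * q) = h (u * X1 ^+ m.+1).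
  by rewrite -[1%:M]/(1 : 'M_n.+1) -(rmorph1 h) -uv rmorphD /= addrK.
have mulh x y : h x *m h y = h (x * y) by rewrite rmorphM.
have hpM x y : x = y * p -> h x = 0 by move=> ->; rewrite rmorphM /= hp mulr0.
have PQ : h (v * q) *m (1%:M - h (v * q)) = 0.
  rewrite hQ mulh; apply: (hpM _ (v * u)); rewrite defm; ring.
have hT : (U - a%:M) *m h (u * X1 ^+ m) = 1%:M - h (v * q).
  by rewrite hQ -hX mulh exprS -/X1; congr (h _); ring.
exists (h (v * q)); split; split.
- by move/eqP: PQ; rewrite mulmxBr mulmx1 subr_eq0 => /eqP.
- by have <- : h 'X = U by [exact: horner_mx_X]; rewrite !mulh mulrC.
(* If [P] were zero, [U - a] would be right invertible, although the row eigenvector [w] kills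
   it. *)
- have /eigenvalueP[w wU] : eigenvalue U a.
    by rewrite eigenvalue_root_char -/p defp root_prod_XsubC.
  apply: contra_neq => P0; rewrite -[w]mulmx1 -[1%:M]subr0 -P0 -hT mulmxA.
  by rewrite mulmxBr wU mul_mx_scalar subrr mul0mx.
- exists m.+1; rewrite -hX -rmorphXn mulh; apply: (hpM _ v); rewrite defm -/X1; ring.
- by eexists; apply: hT.
- move=> b sub; exists (size [seq c <- rs | c != a]).
  have defq : q = ('X - b%:P) ^+ size [seq c <- rs | c != a].
    rewrite /q -big_filter big_seq (eq_bigr (fun=> 'X - b%:P)).
      by rewrite -big_seq big_const_seq iter_mulr_1 count_predT.
    move=> c; rewrite mem_filter => /andP[ca /sub]; rewrite !inE (negPf ca) /=.
    by move=> /eqP->.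
  rewrite hQ -hX -rmorphXn mulh -defq; apply: (hpM _ u); rewrite defm; ring.
Qed.

Definition splits (p : {poly L}) : Prop :=
  exists rs, p = \prod_(c <- rs) ('X - c%:P).

Lemma splits_dvd p q : p \is monic -> p %| q -> splits q -> splits p.
Proof.
move=> pm pq [rs defq]; move: pq; rewrite defq => /dvdp_prod_XsubC[m].
rewrite eqp_monic //; last exact: monic_prod_XsubC.
by move=> /eqP ->; eexists.
Qed.

Lemma char_poly_conj n (G G' U : 'M[L]_n) : G *m G' = 1%:M ->
  char_poly (G' *m U *m G) = char_poly U.
Proof.
move=> GG'; have G'G := mulmx1C GG'; rewrite /char_poly.
have -> : char_poly_mx (G' *m U *m G) =
    map_mx polyC G' *m char_poly_mx U *m map_mx polyC G.
  rewrite /char_poly_mx mulmxBr mulmxBl -!map_mxM; congr (_ - _).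
  by rewrite scalar_mxC -mulmxA -map_mxM G'G map_mx1 mulmx1.
rewrite !det_mulmx mulrAC -det_mulmx -map_mxM G'G map_mx1 det1 mul1r.
by [].
Qed.

Lemma char_poly_block_diag m1 m2 (A : 'M[L]_m1) (B : 'M_m2) :
  char_poly (block_mx A 0 0 B) = char_poly A * char_poly B.
Proof. by rewrite /char_poly char_block_diag_mx det_ublock. Qed.

(** Rank factorizations of [P] and [1 - P] combine into a basis adapted to image and kernel. The
    cross products vanish because [P] and [1 - P] annihilate each other. *)
Lemma idempotent_factor n (P : 'M[L]_n) : P *m P = P ->
  exists m1 m2 (C1 : 'M_(n, m1)) (R1 : 'M_(m1, n)) (C2 : 'M_(n, m2)) (R2 : 'M_(m2, n)),
  n = (m1 + m2)%N /\ [/\ row_mx C1 C2 *m col_mx R1 R2 = 1%:M,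
     col_mx R1 R2 *m row_mx C1 C2 = 1%:M & P = C1 *m R1].
Proof.
have cancel k l l' (C : 'M[L]_(k, l)) R (C' : 'M_(k, l')) (R' : 'M_(l', k)) Z :
    row_full C -> row_free R' -> (C *m R) *m (C' *m R') = C *m Z *m R' -> R *m C' = Z.
  move=> Cfull R'free; rewrite -!mulmxA => /(row_full_inj Cfull).
  by rewrite mulmxA => /(row_free_inj R'free).
have factor k (A : 'M[L]_k) : A *m A = A -> row_base A *m col_base A = 1%:M.
  move=> AA; apply: (cancel _ _ _ _ _ _ _ _ (col_base_full A) (row_base_free A)).
  by rewrite mulmx1 !mulmx_base.
have cross k (A B : 'M[L]_k) : A *m B = 0 -> row_base A *m col_base B = 0.
  move=> AB; apply: (cancel _ _ _ _ _ _ _ _ (col_base_full A) (row_base_free B)).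
  by rewrite mulmx0 mul0mx !mulmx_base.
move=> PP; pose Q := 1%:M - P.
have PQ : P *m Q = 0 by rewrite mulmxBr mulmx1 PP subrr.
have QP : Q *m P = 0 by rewrite mulmxBl mul1mx PP subrr.
have QQ : Q *m Q = Q by rewrite {1}/Q mulmxBl mul1mx PQ subr0.
pose g := row_mx (col_base P) (col_base Q); pose g' := col_mx (row_base P) (row_base Q).
have gg' : g *m g' = 1%:M by rewrite mul_row_col !mulmx_base addrC subrK.
have g'g : g' *m g = 1%:M.
  rewrite mul_col_row !factor // !cross //; exact/esym/scalar_mx_block.
exists (\rank P), (\rank Q), (col_base P), (row_base P), (col_base Q), (row_base Q).
split; last by rewrite mulmx_base.
apply/eqP; rewrite eqn_leq; apply/andP; split.
  by rewrite -{1}(mxrank1 L n) -gg' (leq_trans (mxrankM_maxl _ _)) ?rank_leq_col.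
by rewrite -(mxrank1 L (\rank P + \rank Q)) -g'g (leq_trans (mxrankM_maxl _ _)) ?rank_leq_col.
Qed.

(** After a permutation the adapted basis factors as [lo c *m up r *m Delta] with [Delta] block
    diagonal. As [Delta] commutes with the standard idempotent, the [2 m1 m2] entries of [c] and [r]
    suffice to diagonalize the projection. *)
Lemma idempotent_chart m1 m2 (C1 : 'M[L]_(m1 + m2, m1)) (C2 : 'M_(m1 + m2, m2)) R1 R2 :
  row_mx C1 C2 *m col_mx R1 R2 = 1%:M ->
  exists (s : 'S_(m1 + m2)) c r,
    up (- r) *m lo (- c) *m (perm_mx s *m (C1 *m R1) *m perm_mx s^-1) *m lo c *m up r
    = block_mx 1%:M 0 0 0.
Proof.
move=> gg'; have g'g := mulmx1C gg'.
have C1full : row_full C1.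
  move: g'g; rewrite mul_col_row => /(congr1 ulsubmx).
  rewrite block_mxKul [RHS]/= scalar_mx_block block_mxKul => R1C1.
  apply/row_fullP; by exists R1.
have [s] := row_pivots C1full; set D1 := usubmx _ => D1u.
exists s; set Ps := perm_mx s.
have PsK : Ps *m perm_mx s^-1 = 1%:M by rewrite -perm_mxM mulgV perm_mx1.
pose C12 := usubmx (Ps *m C2).
pose c := dsubmx (Ps *m C1) *m invmx D1.
pose D2 := dsubmx (Ps *m C2) - c *m C12.
have defg : Ps *m row_mx C1 C2 = lo c *m block_mx D1 C12 0 D2.
  rewrite /lo mulmx_block !mul1mx !mul0mx !addr0 /D2 [c *m C12 + _]addrC subrK.
  by rewrite /c mulmxKV // mul_mx_row block_mxEh !vsubmxK.
have D2u : D2 \in unitmx.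
  have : block_mx D1 C12 0 D2 \in unitmx.
    have -> : block_mx D1 C12 0 D2 = lo (- c) *m Ps *m row_mx C1 C2.
      by rewrite -mulmxA defg mulmxA loNK mul1mx.
    rewrite !unitmx_mul unitmx_perm; case/mulmx1_unit: (loNK c) => -> _.
    by case/mulmx1_unit: gg' => ->.
  by rewrite unitmxE det_ublock unitrM => /andP[].
pose r := C12 *m invmx D2; exists c, r.
have defB : block_mx D1 C12 0 D2 = up r *m block_mx D1 0 0 D2.
  by rewrite /up mulmx_block !mul1mx !mul0mx !mulmx0 !addr0 !add0r mulmxKV.
pose Delta := block_mx D1 0 0 D2; pose E0 := block_mx 1%:M 0 0 0 : 'M[L]_(m1 + m2).
have [g defgg] : exists g, g = row_mx C1 C2 by eexists.
have [g' defg'] : exists g', g' = col_mx R1 R2 by eexists.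
have -> : C1 *m R1 = g *m E0 *m g'.
  by rewrite defgg defg' mul_row_block !mulmx0 mulmx1 !addr0 mul_row_col mul0mx addr0.
rewrite -defgg -defg' in gg' defg.
have KD : up (- r) *m lo (- c) *m Ps *m g = Delta.
  by rewrite -(mulmxA _ Ps) defg defB !mulmxA -(mulmxA _ _ (lo c)) loNK mulmx1 upNK mul1mx.
have comm : Delta *m E0 = E0 *m Delta.
  by rewrite !mulmx_block !mulmx1 !mul1mx !mul0mx !mulmx0 !addr0.
have -> : up (- r) *m lo (- c) *m (Ps *m (g *m E0 *m g') *m perm_mx s^-1) *m lo c *m up r
   = up (- r) *m lo (- c) *m Ps *m g *m E0 *m (g' *m perm_mx s^-1 *m lo c *m up r).
  by rewrite !mulmxA.
rewrite KD comm -KD -!mulmxA (mulmxA g) gg' mul1mx (mulmxA Ps) PsK mul1mx.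
by rewrite (mulmxA (lo _)) loNK mul1mx upNK mulmx1.
Qed.

(** Split [M] into nine blocks along [1 = A + B + E]. For each block [X M Y], one of the three given
    projections is orthogonal to both [X] and [Y], and its complementary compression being zero
    kills the block. *)
Lemma compressions_eq0 n (M A B C : 'M[L]_n) :
  A *m B = 0 -> B *m A = 0 -> A *m C = 0 -> C *m A = 0 -> B *m C = 0 -> C *m B = 0 ->
  A *m A = A -> B *m B = B ->
  (1%:M - A) *m M *m (1%:M - A) = 0 -> (1%:M - B) *m M *m (1%:M - B) = 0 ->
  (1%:M - C) *m M *m (1%:M - C) = 0 -> M = 0.
Proof.
move=> AB BA AC CA BC CB AA BB hA hB hC.
have kill (P X Y : 'M[L]_n) : (1%:M - P) *m M *m (1%:M - P) = 0 ->
    X *m P = 0 -> P *m Y = 0 -> X *m M *m Y = 0.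
  move=> hP XP PY; have -> : X = X *m (1%:M - P) by rewrite mulmxBr XP mulmx1 subr0.
  have -> : Y = (1%:M - P) *m Y by rewrite mulmxBl PY mul1mx subr0.
  by rewrite !mulmxA -(mulmxA X) -(mulmxA X) hP mulmx0 mul0mx.
pose E : 'M_n := 1%:M - A - B.
have EA : E *m A = 0 by rewrite !mulmxBl mul1mx AA BA subrr subr0.
have AE : A *m E = 0 by rewrite !mulmxBr mulmx1 AA AB subrr subr0.
have EB : E *m B = 0 by rewrite !mulmxBl mul1mx AB BB subr0 subrr.
have BE : B *m E = 0 by rewrite !mulmxBr mulmx1 BA BB subr0 subrr.
have sum1 : 1%:M = A + B + E by rewrite /E -addrA [B + _]addrC subrK addrC subrK.
clearbody E; rewrite -[M]mul1mx -[_ *m M]mulmx1 sum1 !mulmxDl !mulmxDr.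
rewrite (kill B A A) // (kill C A B) // (kill B A E) //.
rewrite (kill C B A) // (kill A B B) // (kill A B E) //.
by rewrite (kill B E A) // (kill A E B) // (kill A E E) // !addr0.
Qed.

(** With at most two eigenvalues, the complement of one carries a single eigenvalue. With three,
    their projections are mutually orthogonal, and [compressions_eq0] forbids all three
    complementary compressions of [M] to vanish. *)
Lemma separating_projection n (U M : 'M[L]_n) : splits (char_poly U) -> M != 0 ->
  (forall a e, (U - a%:M) ^+ e != 0) ->
  exists a P, [/\ P *m P = P, P *m U = U *m P, P != 0 & 1%:M - P != 0] /\
    [/\ exists e, (U - a%:M) ^+ e *m P = 0,
        exists T : 'M_n, (U - a%:M) *m T = 1%:M - P &
        (1%:M - P) *m M *m (1%:M - P) != 0 \/
        exists b e, (U - b%:M) ^+ e *m (1%:M - P) = 0].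
Proof.
move=> [rs defp] M0 nsing.
pose good a P := [/\ P *m P = P, P *m U = U *m P, P != 0 & 1%:M - P != 0] /\
    [/\ exists e, (U - a%:M) ^+ e *m P = 0,
        exists T : 'M_n, (U - a%:M) *m T = 1%:M - P &
        forall b, {subset rs <= [:: a; b]} ->
          exists e, (U - b%:M) ^+ e *m (1%:M - P) = 0].
have proj a : a \in rs -> exists P, good a P.
  move=> ars; have [P [[PP PU Pn0] [[e Pe] [T PT] hb]]] := spectral_projection defp ars.
  exists P; split; split=> //; [|by exists e|by exists T].
  by apply: contraNneq (nsing a e) => Q0; rewrite -[_ ^+ e]mulmx1 -[1%:M](subrK P) Q0 add0r Pe.
have orth a b P P' : a != b -> good a P -> good b P' -> P *m P' = 0.
  move=> ab [[_ PU _ _] [[e Pe] _ _]] [_ [[e' Pe'] _ _]].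
  apply: (@nilpotent_shift_eq0 _ _ (U - a%:M) _ (b - a) e e').
  - by rewrite subr_eq0 eq_sym.
  - by rewrite mulmxA Pe mul0mx.
  - rewrite raddfB /= opprB addrA subrK.
    have comm k : (U - b%:M) ^+ k *m P = P *m (U - b%:M) ^+ k.
      have c1 : GRing.comm P (U - b%:M).
        by rewrite /GRing.comm -!mulmxE mulmxBl mulmxBr PU mul_mx_scalar mul_scalar_mx.
      by have := commrX k c1; rewrite /GRing.comm -!mulmxE.
    by rewrite mulmxA comm -mulmxA Pe' mulmx0.
suff [a [P [[h1 [h2 h3 h4]] h5]]] : exists a P, good a P /\
    ((1%:M - P) *m M *m (1%:M - P) != 0 \/ exists b, {subset rs <= [:: a; b]}).
  exists a, P; split=> //; split=> //.
  by case: h5 => [|[b /h4[e]]]; [left|right; exists b, e].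
(* Without roots the size [n] would be zero, and so would [M]. *)
have [a ars] : exists a, a \in rs.
  case ers: rs => [|a rs']; last by exists a; rewrite inE eqxx.
  have := size_char_poly U; rewrite defp ers big_nil size_poly1 => -[n0].
  by move: M0; subst n; rewrite thinmx0 eqxx.
have [P gP] := proj a ars.
have [sub|/existsNP[b /not_implyP[brs /negP]]] :=
    pselect (forall b, b \in rs -> b \in [:: a]).
  by exists a, P; split=> //; right; exists a => b /sub; rewrite !inE => ->.
rewrite inE => ba; have [P' gP'] := proj b brs.
have [sub|/existsNP[c /not_implyP[crs /negP]]] :=
    pselect (forall c, c \in rs -> c \in [:: a; b]).
  by exists a, P; split=> //; right; exists b.
rewrite !inE negb_or => /andP[ca cb]; have [P'' gP''] := proj c crs.
have [h1|n1] := eqVneq ((1%:M - P) *m M *m (1%:M - P)) 0; last first.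
  by exists a, P; split=> //; left.
have [h2|n2] := eqVneq ((1%:M - P') *m M *m (1%:M - P')) 0; last first.
  by exists b, P'; split=> //; left.
have [h3|n3] := eqVneq ((1%:M - P'') *m M *m (1%:M - P'')) 0; last first.
  by exists c, P''; split=> //; left.
case/eqP: M0; case: (gP) => -[PP _ _ _] _; case: (gP') => -[PP' _ _ _] _.
have ab : a != b by rewrite eq_sym.
have ac : a != c by rewrite eq_sym.
have bc : b != c by rewrite eq_sym.
apply: (@compressions_eq0 _ M P P' P'') => //;
  by [apply: (orth a b)|apply: (orth b a)|apply: (orth a c)|apply: (orth c a)
     |apply: (orth b c)|apply: (orth c b)].
Qed.

(** * Parameters of a pair with given commutator *)

Lemma single_eigenvalue_span n S (U V : 'M[L]_n) a e : (U - a%:M) ^+ e = 0 ->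
  mxin S (U *m V - V *m U) ->
  exists t, [/\ (size t <= n * n + 1)%N, acl (ext S t) a, mxin (ext S t) U & mxin (ext S t) V].
Proof.
move=> Ne hM; have [s [d [sd h1 h2]]] := nilpotent_span Ne.
have [t1 [st1 ht1]] := h1 S.
have [|t2 [st2 ht2]] := h2 (ext S t1) V ht1.
  apply: mxin_extl; rewrite mulmxBl mulmxBr mul_mx_scalar mul_scalar_mx.
  by rewrite opprB addrA subrK.
(* The eigenvalue costs one parameter, on top of [s + d = n * n] for the nilpotent part and [V]. *)
exists (a :: t1 ++ t2); set T := ext S _.
have ha : acl T a by apply: acl_in; right; rewrite inE eqxx.
split=> //; first by rewrite /= size_cat; lia.
- rewrite -[U](subrK a%:M); apply: mxinD; last exact: mxin_scalar.
  by apply: mxin_ext_sub ht1 => x xt; rewrite inE mem_cat xt orbT.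
- move/mxin_ext_cat: ht2; apply: mxin_ext_sub => x xt.
  by rewrite inE xt orbT.
Qed.

(** The alternative to a nonzero commutator, a single eigenvalue of [U], is there for the induction:
    it covers the second diagonal block when its commutator vanishes. *)
Lemma commutator_span n S (U V : 'M[L]_n) :
  (forall m, (0 < m <= n)%N -> m%:R != 0 :> L) ->
  splits (char_poly U) -> mxin S (U *m V - V *m U) ->
  U *m V - V *m U != 0 \/ (exists a e, (U - a%:M) ^+ e = 0) ->
  exists t, [/\ (size t <= n * n + 1)%N, mxin (ext S t) U & mxin (ext S t) V].
Proof.
elim/ltn_ind: n => n ih in S U V *; move=> hchar hU hM0 hyp.
have [[a [e Ne]]|nsing] := pselect (exists a e, (U - a%:M) ^+ e = 0).
  by have [t [st _ hU' hV']] := single_eigenvalue_span Ne hM0; exists t.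
have Mn0 : U *m V - V *m U != 0 by case: hyp.
have {}nsing a e : (U - a%:M) ^+ e != 0.
  by apply/eqP => h; apply: nsing; exists a, e.
have [a [P [[PP PU Pn0 Qn0] [[e Pe] [T PT] hQ]]]] := separating_projection hU Mn0 nsing.
have [m1 [m2 [C1 [R1 [C2 [R2 [defn [gg' g'g defP]]]]]]]] := idempotent_factor PP.
have m1_gt0 : (0 < m1)%N.
  rewrite lt0n; apply: contraNneq Pn0 => m10; subst m1.
  by rewrite defP [C1]thinmx0 mul0mx.
have m2_gt0 : (0 < m2)%N.
  rewrite lt0n; apply: contraNneq Qn0 => m20; subst m2.
  by rewrite -gg' mul_row_col defP [C2]thinmx0 mul0mx addr0 subrr.
subst n.
have [s [c [r PE]]] := idempotent_chart gg'; rewrite -{}defP in PE.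
set M := U *m V - V *m U in hM0 Mn0 hQ.
pose M1 := perm_mx s *m M *m perm_mx s^-1.
have Ps : perm_mx s *m perm_mx s^-1 = 1%:M :> 'M[L]_(m1 + m2).
  by rewrite -perm_mxM mulgV perm_mx1.
have Ps' : perm_mx s^-1 *m perm_mx s = 1%:M :> 'M[L]_(m1 + m2).
  by rewrite -perm_mxM mulVg perm_mx1.
have [H defH] : exists H, H = perm_mx s^-1 *m lo c *m up r by eexists.
have [H' defH'] : exists H', H' = up (- r) *m lo (- c) *m perm_mx s by eexists.
have H'H : H' *m H = 1%:M.
  rewrite defH defH' -!mulmxA (mulmxA (perm_mx s)) Ps mul1mx.
  by rewrite (mulmxA (lo _)) loNK mul1mx upNK.
have HH' := mulmx1C H'H.
pose conj X := H' *m X *m H.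
have conjM X Y : conj (X *m Y) = conj X *m conj Y.
  by rewrite /conj !mulmxA -(mulmxA _ H) HH' mulmx1.
have conjB X Y : conj (X - Y) = conj X - conj Y.
  by rewrite /conj mulmxBr mulmxBl.
have conj_scalar b : conj b%:M = b%:M.
  by rewrite /conj mul_mx_scalar -scalemxAl H'H scalemx1.
have conj00 : conj 0 = 0 by rewrite /conj mulmx0 mul0mx.
have conjX X k : conj (X ^+ k) = conj X ^+ k.
  by elim: k => [|k ihk]; rewrite ?conj_scalar // !exprS -!mulmxE conjM ihk.
have conjK X : X = H *m conj X *m H'.
  by rewrite /conj !mulmxA HH' mul1mx -mulmxA HH' mulmx1.
have conj0 X : conj X = 0 -> X = 0 by move=> h; rewrite (conjK X) h mulmx0 mul0mx.
have conjP : conj P = block_mx 1%:M 0 0 0.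
  by rewrite -PE /conj defH defH' !mulmxA.
have conjQ : conj (1%:M - P) = block_mx 0 0 0 1%:M.
  rewrite conjB conj_scalar conjP scalar_mx_block opp_block_mx add_block_mx.
  by rewrite !subrr !subr0.
(* [U] commutes with [P], so it is block diagonal in the adapted basis. *)
have [U1 [U2 defU]] : exists U1 U2, conj U = block_mx U1 0 0 U2.
  have : conj P *m conj U = conj U *m conj P by rewrite -!conjM PU.
  move: (conj U) => W; rewrite conjP -[W]submxK !mulmx_block.
  rewrite !mul1mx !mul0mx !mulmx1 !mulmx0 !addr0 => /eq_block_mx[_ -> <- _].
  by exists (ulsubmx W), (drsubmx W).
have defUb b : conj (U - b%:M) = block_mx (U1 - b%:M) 0 0 (U2 - b%:M).
  by rewrite conjB conj_scalar defU scalar_mx_block opp_block_mx add_block_mx !oppr0 !addr0.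
have [V11 [V12 [V21 [V22 defV]]]] : exists V11 V12 V21 V22,
    conj V = block_mx V11 V12 V21 V22.
  exists (ulsubmx (conj V)), (ursubmx (conj V)).
  by exists (dlsubmx (conj V)), (drsubmx (conj V)); rewrite submxK.
have defM : conj M = block_mx (U1 *m V11 - V11 *m U1) (U1 *m V12 - V12 *m U2)
                              (U2 *m V21 - V21 *m U1) (U2 *m V22 - V22 *m U2).
  rewrite conjB !conjM defU defV !mulmx_block opp_block_mx add_block_mx.
  by rewrite !mul0mx !mulmx0 !addr0 !add0r.
have U1e : (U1 - a%:M) ^+ e = 0.
  have := congr1 conj Pe; rewrite conjM conjX defUb conjP.
  have [B' ->] := block_exprmx (U1 - a%:M) 0 (U2 - a%:M) e.
  rewrite mulmx_block mulmx1 mulmx0 addr0 => /(congr1 ulsubmx).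
  by rewrite block_mxKul conj00 => ->; apply/matrixP => i j; rewrite !mxE.
have U2u : U2 - a%:M \in unitmx.
  have := congr1 conj PT; rewrite conjM conjQ defUb -[conj T]submxK mulmx_block.
  rewrite !mul0mx !add0r => /(congr1 drsubmx).
  by rewrite !block_mxKdr => /mulmx1_unit[].
have hU2 : splits (char_poly U2).
  apply: splits_dvd hU; first exact: char_poly_monic.
  by rewrite -(char_poly_conj _ HH') -/(conj U) defU char_poly_block_diag dvdp_mull.
have [t0 [st0 hc hr]] : exists t, [/\ (size t < 2 * (m1 * m2))%N,
    mxin (ext S t) c & mxin (ext S t) r].
  apply: (@trace_block_dependence S m1 m2 M1) => //.
  (* A scalar commutator [b] has trace [n b = 0], and [n] is nonzero in [L], so [b = 0]. *)
  - move=> b; apply: contraNneq Mn0 => M1b.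
    have Mb : M = b%:M.
      rewrite -[M]mul1mx -Ps' -[_ *m M]mulmx1 -Ps' !mulmxA.
      rewrite -(mulmxA _ (perm_mx s)) -(mulmxA _ _ (perm_mx s^-1)).
      by rewrite -/M1 M1b mul_mx_scalar -scalemxAl Ps' scalemx1.
    have : \tr M = 0 by rewrite /M raddfB /= mxtrace_mulC subrr.
    rewrite Mb mxtrace_scalar -mulr_natr => /eqP.
    rewrite mulf_eq0 (negPf (hchar _ _)) ?orbF ?leqnn ?andbT ?addn_gt0 ?m1_gt0 //.
    by move/eqP->; rewrite -scalemx1 scale0r.
  - by do 2?apply: mxinM => //; apply: mxin_perm.
  - have -> : up (- r) *m (lo (- c) *m M1 *m lo c) *m up r = conj M.
      by rewrite /conj /M1 defH defH' !mulmxA.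
    by rewrite defM block_mxKul raddfB /= mxtrace_mulC subrr.
set S0 := ext S t0 in hc hr.
have hH : mxin S0 H.
  by rewrite defH; do 2?apply: mxinM; [exact: mxin_perm|exact: mxin_lo|exact: mxin_up].
have hH' : mxin S0 H'.
  rewrite defH'; do 2?apply: mxinM; [| |exact: mxin_perm].
    by apply/mxin_up/mxinN.
  by apply/mxin_lo/mxinN.
have : mxin S0 (conj M) by do 2?apply: mxinM => //; apply: mxin_extl.
rewrite defM => /mxin_block[h11 h12 h21 h22].
have [t1 [st1 ha1 hU1 hV11]] := single_eigenvalue_span U1e h11.
set S1 := ext S0 t1 in ha1 hU1 hV11.
have [|||t2 [st2 hU2' hV22]] := ih m2 _ S1 U2 V22 _ hU2 (mxin_extl _ h22).
- by rewrite -[X in (X < _)%N]add0n ltn_add2r.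
- by move=> m /andP[m0 mm]; rewrite hchar // m0 (leq_trans mm) ?leq_addl.
(* In the adapted basis, compressing to the complement of [P] keeps exactly the block
   [[U2, V22]]. *)
- case: hQ => [nz|[b [e' hb]]]; [left|right].
    apply: contraNneq nz => M22; apply/eqP/conj0.
    rewrite !conjM conjQ defM M22 !mulmx_block.
    by rewrite !(mul0mx, mulmx0, mulmx1, mul1mx, addr0, add0r) -[RHS](block_mx_const _ _ _ _ 0).
  exists b, e'; have := congr1 conj hb; rewrite conjM conjX defUb conjQ.
  have [B' ->] := block_exprmx (U1 - b%:M) 0 (U2 - b%:M) e'.
  rewrite conj00 mulmx_block !(mulmx1, mulmx0, mul0mx, add0r) => /(congr1 drsubmx).
  by rewrite block_mxKdr => ->; apply/matrixP => i j; rewrite !mxE.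
set S2 := ext S1 t2 in hU2' hV22.
have S12 m n (X : 'M_(m, n)) : mxin S1 X -> mxin S2 X by apply: mxin_extl.
have S02 m n (X : 'M_(m, n)) : mxin S0 X -> mxin S2 X by move=> h; apply/S12/mxin_extl.
have ha : acl S2 a by apply: acl_subset ha1 => x; left.
have hV12 : mxin S2 V12.
  by apply: (sylvester U1e U2u ha); auto.
have hV21 : mxin S2 V21.
  (* In the equation for [V21] the factors [U1] and [U2] have changed sides; transposing brings it
     to the form solved by [sylvester]. *)
  rewrite -[V21]trmxK; apply: mxin_tr.
  apply: (@sylvester S2 _ _ U1^T U2^T _ a e) => //.
  - by rewrite -tr_scalar_mx -raddfB /= exprmx_tr U1e trmx0.
  - by rewrite -tr_scalar_mx -raddfB /= unitmx_tr.
  - by apply/mxin_tr/S12.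
  - exact/mxin_tr.
  - rewrite -!trmx_mul -raddfB /= -opprB raddfN /=.
    by apply/mxinN/mxin_tr/S02.
exists (t0 ++ t1 ++ t2).
suff h X : mxin S2 (conj X) -> mxin (ext S (t0 ++ t1 ++ t2)) X.
  (* The count is at most [(2 m1 m2 - 1) + (m1 ^ 2 + 1) + (m2 ^ 2 + 1) = (m1 + m2) ^ 2 + 1]. *)
  split; first by rewrite !size_cat; nia.
  - apply: h; rewrite defU; apply/mxin_block; split; auto; exact: mxin0.
  - by apply: h; rewrite defV; apply/mxin_block; split; auto.
move=> hX; rewrite catA; apply/mxin_ext_cat.
have sub x : S2 x -> acl (ext (ext S (t0 ++ t1)) t2) x.
  move=> [h|h]; last by apply: acl_in; right.
  have : acl (ext S (t0 ++ t1)) x by apply/acl_ext_cat/acl_in.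
  by apply: acl_subset => y; left.
apply: (mxin_trans sub); rewrite (conjK X).
by apply: mxinM; [apply: mxinM => //|]; apply: S02.
Qed.

End Commutators.

(** * Residue fields and splitting fields *)

Section ResidueField.

Variable R : comNzRingType.

Definition prime_ideal (P : R -> Prop) : Prop :=
  [/\ P 0, ~ P 1, forall a u v, P u -> P v -> P (a * u + v)
    & forall u v, P (u * v) -> P u \/ P v].

Variables (P : R -> Prop) (hP : prime_ideal P).

Definition ideal_pred (_ : prime_ideal P) : R -> bool := fun x => `[< P x >].

Lemma ideal_pred_closed : idealr_closed (ideal_pred hP).
Proof.
have [P0 P1 PD _] := hP; split; first exact/asboolP.
  by apply/asboolPn.
by move=> a u v /asboolP Pu /asboolP Pv; apply/asboolP/PD.
Qed.

Lemma ideal_pred_prime : prime_idealr_closed (ideal_pred hP).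
Proof.
have [_ _ _ PM] := hP.
by move=> u v /asboolP/PM[h|h]; apply/orP; [left|right]; apply/asboolP.
Qed.

HB.instance Definition _ := isIdealr.Build R (ideal_pred hP) ideal_pred_closed.
HB.instance Definition _ :=
  isPrimeIdealrClosed.Build R (ideal_pred hP) ideal_pred_prime.

Definition prime_idealr_of : prime_idealr R := PrimeIdealr.clone R (ideal_pred hP) _.

Definition residue_ring := {ideal_quot prime_idealr_of}.
HB.instance Definition _ := GRing.ComNzRing.on residue_ring.

(** Units and inverses are chosen classically, to make the quotient an integral domain with a
    fraction field. *)
Definition residue_unit : {pred residue_ring} := fun x => `[< exists y, y * x = 1 >].
Definition residue_inv (x : residue_ring) : residue_ring :=
  if pselect (exists y, y * x = 1) is left h then sval (cid h) else x.

Lemma residue_mulVx : {in residue_unit, left_inverse 1 residue_inv *%R}.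
Proof.
by move=> x /asboolP h; rewrite /residue_inv; case: pselect => // h'; case: (cid h').
Qed.

Lemma residue_unitPl x y : y * x = 1 -> residue_unit x.
Proof. by move=> h; apply/asboolP; exists y. Qed.

Lemma residue_inv_out : {in [predC residue_unit], residue_inv =1 id}.
Proof. by move=> x /asboolPn h; rewrite /residue_inv; case: pselect. Qed.

HB.instance Definition _ := GRing.ComNzRing_hasMulInverse.Build residue_ring
  residue_mulVx residue_unitPl residue_inv_out.
HB.instance Definition _ := GRing.ComUnitRing_isIntegral.Build residue_ring
  (@Quotient.rquot_IdomainAxiom R prime_idealr_of).

(** For the ideal of an irreducible set this is the function field, and the images of the
    coordinates form the generic point. *)
Lemma residue_field : exists (L : fieldType) (ev : {rmorphism R -> L}),
  forall f, ev f = 0 <-> P f.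
Proof.
pose q : {rmorphism R -> residue_ring} := \pi_residue_ring%qT.
have q0 f : (q f == 0) = (f \in prime_idealr_of).
  by rewrite -[f in RHS]subr0 Quotient.idealrBE -(rmorph0 q).
exists {fraction residue_ring}, (@tofrac residue_ring \o q) => f.
split=> [/eqP|Pf]; last apply/eqP; rewrite /= tofrac_eq0 q0; first by move/asboolP.
exact/asboolP.
Qed.

End ResidueField.

Lemma irreducible_factor (F : fieldType) (p : {poly F}) : (1 < size p)%N ->
  exists2 q, irreducible_poly q & q %| p.
Proof.
have [m] := ubnP (size p); elim: m => // m ih in p *; rewrite ltnS => pm p1.
have [irr|nirr] := pselect (irreducible_poly p); first by exists p.
have [q [q1 qp nqp]] : exists q : {poly F}, [/\ size q != 1%N, q %| p & ~~ (q %= p)].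
  apply: contrapT => h; apply: nirr; split=> // q q1 qp; apply/negPn/negP => nqp.
  by apply: h; exists q.
have p0 : p != 0 by rewrite -size_poly_gt0 ltnW.
have q0 : q != 0 by apply: contraNneq p0 => q0; move: qp; rewrite q0 dvd0p.
have lt_qp : (size q < size p)%N.
  by rewrite ltn_neqAle (dvdp_leq p0 qp) andbT dvdp_size_eqp.
have [|| q' irr q'q] := ih q; first exact: leq_trans pm.
  by rewrite ltn_neqAle eq_sym q1 size_poly_gt0.
by exists q' => //; apply: dvdp_trans qp.
Qed.

(** Induction on the degree, over all base fields at once: adjoin a root of an irreducible factor
    and split the cofactor. *)
Lemma splitting_extension (F : fieldType) (p : {poly F}) : p \is monic ->
  exists (E : fieldType) (i : {rmorphism F -> E}) rs,
    map_poly i p = \prod_(c <- rs) ('X - c%:P).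
Proof.
have [m] := ubnP (size p); elim: m => // m ih in F p *; rewrite ltnS => pm pmon.
have [p1|p1] := leqP (size p) 1.
  exists F, idfun, [::]; rewrite big_nil map_poly_id //.
  by apply/eqP; rewrite -eqp_monic ?monic1 // -size_poly_eq1 eqn_leq p1 size_poly_gt0 monic_neq0.
have [q irr qp] := irreducible_factor p1.
have [L _ [z qz _]] := irredp_FAdjoin irr.
pose j : {rmorphism F -> L} := in_alg L.
have /dvdpP[p' defp'] : 'X - z%:P %| map_poly j p.
  by apply: (@dvdp_trans _ (map_poly j q)); rewrite ?dvdp_map // -root_factor_theorem.
have p'mon : p' \is monic by rewrite -(monicMr _ (monicXsubC z)) -defp' map_monic.
have [|//|E [i [rs defi]]] := ih L p'.
  apply: leq_trans pm; rewrite -(size_map_poly j p) defp' size_Mmonic ?monic_neq0 ?monicXsubC //.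
  by rewrite size_XsubC addn2.
exists E, (i \o j), (i z :: rs).
by rewrite map_poly_comp /= defp' rmorphM /= defi big_cons map_polyXsubC mulrC.
Qed.

(** * Chains of irreducible closed sets *)

Section Chains.

Variables (K : closedFieldType) (N : nat).
Local Notation kx := {mpoly K[N]}.
Implicit Types (X Z : 'rV[K]_N -> Prop) (f : {mpoly K[N]}).

Definition vanish f Z : Prop := forall x, Z x -> f.@[fun i => x 0 i] = 0.

(** The zero sets of [f] and [g] in [Z] are closed and together cover [Z]. *)
Lemma vanish_prime Z f g : irreducible Z -> vanish (f * g) Z -> vanish f Z \/ vanish g Z.
Proof.
move=> [_ irr] fg.
have closed_vanish h : closed_in Z (fun x => Z x /\ h.@[fun i => x 0 i] = 0).
  exists (eq h) => x; split=> -[Zx hx]; split=> //; first by move=> _ <-.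
  exact: hx.
have [x Zx|h|h] := irr _ _ (closed_vanish f) (closed_vanish g).
- have /eqP := fg x Zx; rewrite mevalM mulf_eq0 => /orP[] /eqP; by [left|right].
- by left=> x /h[].
- by right=> x /h[].
Qed.

Lemma vanish_prime_ideal Z : irreducible Z -> prime_ideal (fun f : kx => vanish f Z).
Proof.
move=> irr; have [[x Zx] _] := irr; split.
- by move=> y _; rewrite meval0.
- by move=> /(_ x Zx)/eqP; rewrite meval1 oner_eq0.
- by move=> a u v hu hv y Zy; rewrite mevalD mevalM hu ?hv // mulr0 addr0.
- by move=> u v; apply: vanish_prime.
Qed.

(* If f_(i+1) vanishes on Z_i but not on Z_(i+1), a relation between f_1, ...,
   f_(i+1) on Z_(i+1) can be divided by f_(i+1) until its constant term does not
   vanish; restricting to Z_i gives a relation between f_1, ..., f_i. *)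
Lemma chain_independent X k Zs : irreducible_chain X k Zs ->
  exists s : seq kx, size s = k /\
    forall (L : fieldType) (ev : {rmorphism kx -> L}),
      (forall f, ev f = 0 -> vanish f (Zs k)) ->
      indep (fun x => exists c, x = ev c%:MP) (map ev s).
Proof.
move=> [hirr hstrict].
(* [A] stands for a polynomial ring over [K] in [i] variables, and [phi] substitutes the chosen
   functions; only zero is sent to a function vanishing on [Zs i]. *)
suff: forall i, (i <= k)%N -> exists s : seq kx, size s = i /\
    exists (A : idomainType) (phi : {rmorphism A -> kx}),
    [/\ forall a, vanish (phi a) (Zs i) -> a = 0,
        forall c, exists a, phi a = c%:MP,
        forall f, f \in s -> exists a, phi a = f
      & forall (L : fieldType) (ev : {rmorphism kx -> L}),
        (forall f, ev f = 0 -> vanish f (Zs i)) ->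
        indep (fun x => exists c, x = ev c%:MP) (map ev s)].
  by move=> /(_ k (leqnn k))[s [ss [A [phi [_ _ _ h]]]]]; exists s.
elim=> [_|i ih ik].
  exists [::]; split=> //; exists K, (@mpolyC N K); split=> //; last by move=> c; exists c.
  have [_ [[x Zx] _]] := hirr 0%N (leq0n k).
  by move=> a /(_ x Zx); rewrite mevalC.
have [s [ss [A [phi [phi_inj phiC phis ind]]]]] := ih (ltnW ik).
have [sub nsub] := hstrict i ik.
have [[S closedS] _] := hirr i (ltnW ik).
have [closedS' irr'] := hirr i.+1 ik.
(* Otherwise every equation of [Zs i] would hold on [Zs i.+1], against strictness of the chain. *)
have [f fi fi'] : exists2 f, vanish f (Zs i) & ~ vanish f (Zs i.+1).
  apply: contrapT => h; apply: nsub => x Zx; apply/closedS; split.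
    by case: closedS' => S' /(_ x)[/(_ Zx)[]].
  move=> g Sg; apply: contrapT => gx; apply: h; exists g; last by move=> /(_ x Zx).
  by move=> y /closedS[_]; apply.
exists (f :: s); split; first by rewrite /= ss.
pose phi' : {rmorphism {poly A} -> kx} := (horner_eval f \o map_poly phi).
have phi'E p : phi' p = (map_poly phi p).[f] by [].
have phi'C a : phi' a%:P = phi a by rewrite phi'E map_polyC hornerC.
have phi'X : phi' 'X = f by rewrite phi'E map_polyX hornerX.
clearbody phi'.
have phi'_inj p : vanish (phi' p) (Zs i.+1) -> p = 0.
  elim/poly_ind: p => // p a ihp; rewrite rmorphD rmorphM /= phi'C phi'X => van.
  have a0 : a = 0.
    apply: phi_inj => x Zx; have := van x (sub x Zx).
    by rewrite mevalD mevalM fi // mulr0 add0r.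
  move: van; rewrite a0 rmorph0 addr0 => /(vanish_prime irr')[/ihp -> | //].
  by rewrite mul0r polyC0 addr0.
exists {poly A}, phi'; split=> //.
- by move=> c; have [a <-] := phiC c; exists a%:P.
- move=> g; rewrite inE => /predU1P[->|/phis[a <-]]; first by exists 'X.
  by exists a%:P.
move=> L ev hev /=; split; last first.
  by apply: ind => g /hev hg x Zx; apply/hg/sub.
(* A dependence of [f] on the earlier functions lifts to a polynomial [q] over [A] with [phi' q]
   vanishing on [Zs i.+1], hence [q = 0]. *)
move=> dep; pose R x := exists a, x = ev (phi a).
have [||p [p0 /boolp.choice[a ha] pf]] := algebraic_over_subring (R := R) _ _ dep.
- split; first by exists 1; rewrite !rmorph1.
  + by move=> _ _ [a ->] [b ->]; exists (a - b); rewrite !rmorphB.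
  + by move=> _ _ [a ->] [b ->]; exists (a * b); rewrite !rmorphM.
- move=> x [[c ->]|/mapP[g /phis[a <-] ->]]; last by exists a.
  by have [a <-] := phiC c; exists a.
pose q := \poly_(j < size p) a j.
have /phi'_inj q0 : vanish (phi' q) (Zs i.+1).
  apply: hev; have /eqP <- := pf; rewrite (horner_coef p).
  rewrite /q poly_def !rmorph_sum /=; apply: eq_bigr => j _.
  by rewrite -mul_polyC rmorphM rmorphXn /= phi'C phi'X rmorphM rmorphXn /= -ha.
case/eqP: p0; apply/polyP => j; rewrite coef0; have [jp|jp] := ltnP j (size p).
  rewrite ha; have -> : a j = q`_j by rewrite coef_poly jp.
  by rewrite q0 coef0 !rmorph0.
by rewrite nth_default.
Qed.

Lemma acl_eval (L : fieldType) (ev : {rmorphism kx -> L}) S f :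
  (forall c, S (ev c%:MP)) -> (forall i, acl S (ev 'X_i)) -> acl S (ev f).
Proof.
move=> hC hX; rewrite [f]mpolyE rmorph_sum /=.
elim/big_ind: _ => [|x y|m _]; [exact: acl0|exact: aclD|].
rewrite -mul_mpolyC rmorphM /=; apply: aclM; first exact: acl_in.
rewrite mpolyXE_id rmorph_prod /=; apply: acl_prod => i.
by rewrite rmorphXn; apply: aclX.
Qed.

End Chains.

(** * The bound at the generic point *)

Theorem theorem2p2 (n : nat) (hn : (2 <= n)%N) :
  exists p0 : nat, forall p : nat, prime p -> (p0 <= p)%N ->
  forall (K : closedFieldType) (iota : {rmorphism 'F_p -> K}),
    is_algebraic_closure iota ->
  forall M : 'M[K]_n, M != 0 -> \tr M = 0 ->
    dim_le (commutator_fibre M) (n ^ 2 + 1)%N.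
Proof.
(* [p > n] makes the integers from 1 to [n] nonzero in characteristic [p]. *)
exists n.+1 => p p_pr lt_np K iota _ M M0 _ k Zs chain.
have [closedZ irrZ] := chain.1 k (leqnn k).
have [L [ev hev]] := residue_field (vanish_prime_ideal irrZ).
pose Ug : 'M[{mpoly K[n * n + n * n]}]_n :=
  \matrix_(i, j) 'X_(lshift (n * n) (mxvec_index i j)).
pose Vg : 'M[{mpoly K[n * n + n * n]}]_n :=
  \matrix_(i, j) 'X_(rshift (n * n) (mxvec_index i j)).
pose constK : {rmorphism K -> {mpoly K[n * n + n * n]}} := @mpolyC _ K.
(* The entries of [g] are the equations of the fibre; they vanish on the top set [Zs k], so the
   generic pair satisfies them. *)
pose g := Ug *m Vg - Vg *m Ug - map_mx constK M.
have ev_g : map_mx ev g = 0.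
  apply/matrixP => i j; rewrite [LHS]mxE [RHS]mxE; apply/hev => x Zx.
  have [U [V [-> UV]]] : commutator_fibre M x.
    by case: closedZ => S /(_ x)[/(_ Zx)[]].
  pose e : {rmorphism {mpoly K[n * n + n * n]} -> K} :=
    meval (fun i => pair_point U V 0 i).
  have -> : (g i j).@[fun i => pair_point U V 0 i] = map_mx e g i j by rewrite [RHS]mxE.
  have eU : map_mx e Ug = U.
    by apply/matrixP => a b; rewrite !mxE [LHS]mevalXU row_mxEl mxvecE.
  have eV : map_mx e Vg = V.
    by apply/matrixP => a b; rewrite !mxE [LHS]mevalXU row_mxEr mxvecE.
  have eM : map_mx e (map_mx constK M) = M.
    by apply/matrixP => a b; rewrite !mxE [LHS]mevalC.
  by rewrite !map_mxB !map_mxM eU eV eM UV subrr mxE.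
have [E [i [rs def_rs]]] := splitting_extension (char_poly_monic (map_mx ev Ug)).
pose j : {rmorphism {mpoly K[n * n + n * n]} -> E} := i \o ev.
pose S x := exists c, x = j c%:MP.
pose U := map_mx j Ug; pose V := map_mx j Vg.
have UV : U *m V - V *m U = map_mx (j \o constK) M.
  have : map_mx i (map_mx ev g) = 0 by rewrite ev_g map_mx0.
  by rewrite -map_mx_comp -/j !map_mxB !map_mxM -map_mx_comp => /subr0_eq.
have pE : p \in [pchar E] by apply/(rmorph_pchar (j \o constK))/(rmorph_pchar iota)/pchar_Fp.
have [||||t [st hU hV]] := @commutator_span E n S U V.
- move=> m /andP[m0 mn]; rewrite -(dvdn_pcharf pE).
  by rewrite gtnNdvd // (leq_ltn_trans mn).
- by exists rs; rewrite -def_rs map_char_poly -map_mx_comp.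
- by move=> a b; rewrite UV mxE; apply: acl_in; eexists.
- by left; rewrite UV map_mx_eq0.
(* The chain gives [k] independent functions, all algebraic over the constants and [t], so
   [steinitz] bounds [k] by the size of [t]. *)
have [s [ss ind]] := chain_independent chain.
rewrite -mulnn; apply: leq_trans st; rewrite -ss -(size_map j s).
apply: (@steinitz _ S); first apply: ind => f.
  by move=> /= /eqP; rewrite fmorph_eq0 => /eqP/hev.
move=> _ /mapP[f _ ->]; apply: acl_eval => [c|l]; first by left; exists c.
case: (split_ordP l) => l' ->; case/mxvec_indexP: l' => a b.
  by have := hU a b; rewrite !mxE.
by have := hV a b; rewrite !mxE.
Qed.
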